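(* Let $d\ge1$. For any measurable $f:\mathbb{T}^d\to[0,1]$, we have $$H(\mathbb{P}^f)\ \ge\ \min\Big\{H\big[\mathrm{GM}(f)\big],\,H\big[\mathrm{GM}(\mathbf 1-f)\big]\Big\}.$$
   Context: $\mathbb{T}^d:=\mathbb{R}^d/\mathbb{Z}^d$ with unit Lebesgue measure $\lambda_d$; $\widehat f(k):=\int_{\mathbb{T}^d} f(x)e^{-2\pi i k\cdot x}\,d\lambda_d(x)$. For measurable $f:\mathbb{T}^d\to[0,1]$, $\mathbb{P}^f$ is the unique Borel probability measure on $\{0,1\}^{\mathbb{Z}^d}$ such that for all $k\ge1$ and all distinct $e_1,\dots,e_k\in\mathbb{Z}^d$, $\mathbb{P}^f[\eta(e_1)=1,\dots,\eta(e_k)=1]=\det[\widehat f(e_j-e_i)]_{1\le i,j\le k}$ (it exists and is translation invariant). $\mathrm{GM}(f):=\exp\int_{\mathbb{T}^d}\log f\,d\lambda_d$ (with $\log 0=-\infty$, $\exp(-\infty)=0$). $\mathbf 1$ is the constant function 1. $H(\mu)$ is the (Kolmogorov–Sinai) entropy of the translation action of $\mathbb{Z}^d$ on $(\{0,1\}^{\mathbb{Z}^d},\mu)$, computed with natural logarithms, and for $p\in[0,1]$, $H[p]:=-p\log p-(1-p)\log(1-p)$ (with $0\log0=0$). *)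

(* Defs.v *)
From HB Require Import structures.
From mathcomp Require Import all_boot all_order all_algebra.
From mathcomp Require Import all_classical all_reals all_analysis.
From mathcomp Require Import complex.

Set Implicit Arguments.
Unset Strict Implicit.
Unset Printing Implicit Defensive.

Import Order.TTheory GRing.Theory Num.Theory.
Import numFieldNormedType.Exports.

Local Open Scope classical_set_scope.
Local Open Scope ring_scope.

(* Functions on T^d = R^d / Z^d are represented by Z^d-periodic functions on R^d = d.-tuple R
   and integrated against [torus_measure], the law of d independent uniform
   variables on [0, 1], which is Lebesgue measure on the unit cube. *)

Definition Zd_periodic (R : realType) (d : nat) (T : Type) (f : d.-tuple R -> T) :=
  forall (x : d.-tuple R) (k : 'rV[int]_d),
    f [tuple tnth x i + (k ord0 i)%:~R | i < d] = f x.

Definition tuple_cons (R : realType) (d : nat) (z : measurableTypeR R * d.-tuple R) :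
    d.+1.-tuple R :=
  [tuple of z.1 :: z.2].

Lemma measurable_tuple_cons (R : realType) (d : nat) :
  measurable_fun [set: measurableTypeR R * d.-tuple R] (@tuple_cons R d).
Proof.
apply: (@measurable_cons _ _ _ R fst d snd); last exact: measurable_snd.
exact: (@measurable_fst _ _ (measurableTypeR R)).
Qed.

HB.instance Definition _ (R : realType) (d : nat) :=
  isMeasurableFun.Build _ _ _ _ (@tuple_cons R d)
    (@measurable_tuple_cons R d).

Fixpoint torus_measure (R : realType) (d : nat) : probability (d.-tuple R) R :=
  match d return probability (d.-tuple R) R with
  | 0 => dirac [tuple]
  | d'.+1 => distribution
      ((uniform_prob (@ltr01 R) \x torus_measure R d')%E : probability _ R)
      (@tuple_cons R d')
  end.

Definition cintegral d (T : measurableType d) (R : realType)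
    (mu : {measure set T -> \bar R}) (g : T -> R[i]) : R[i] :=
  Complex (\int[mu]_x complex.Re (g x)) (\int[mu]_x complex.Im (g x)).

Definition expi (R : realType) (t : R) : R[i] := Complex (cos t) (sin t).

Definition dotZ (R : realType) (d : nat) (k : 'rV[int]_d) (x : d.-tuple R) : R :=
  \sum_(i < d) (k ord0 i)%:~R * tnth x i.

Definition fourier (R : realType) (d : nat) (f : d.-tuple R -> R)
    (k : 'rV[int]_d) : R[i] :=
  cintegral (torus_measure R d)
    (fun x => (f x)%:C%C * expi (- (2 * pi * dotZ k x))).

(* [lne 0 = -oo] and [expeR -oo = 0]; the integral lies in [-oo, 0] when
   0 <= f <= 1. *)
Definition GM (R : realType) (d : nat) (f : d.-tuple R -> R) : R :=
  fine (expeR (\int[torus_measure R d]_x lne (f x)%:E)%E).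

(* {0,1}^(Z^d) with the Borel sigma-algebra of the product topology. *)
Definition config (d : nat) : Type :=
  g_sigma_algebraType (@open {ptws 'rV[int]_d -> bool}).

HB.instance Definition _ (d : nat) := Measurable.on (config d).

Definition config_shift (d : nat) (v : 'rV[int]_d) (eta : config d) : config d :=
  fun e => eta (e + v).

(* P^f is the unique Borel probability measure P with this property. *)
Definition determinantal (R : realType) (d : nat) (f : d.-tuple R -> R)
    (P : probability (config d) R) :=
  forall (k : nat) (e : 'I_k -> 'rV[int]_d), (1 <= k)%N -> injective e ->
    (fine (P [set eta | forall i, eta (e i) = true]))%:C%C =
    \det (\matrix_(i < k, j < k) fourier f (e j - e i)).

(* H[p]; in the library [ln 0 = 0], so that 0 log 0 = 0. *)
Definition entropy2 (R : realType) (p : R) : R :=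
  - p * ln p - (1 - p) * ln (1 - p).

(* Shannon entropy of the partition of T into the fibres of xi. *)
Definition partition_entropy d (T : measurableType d) (R : realType)
    (mu : probability T R) (A : finType) (xi : T -> A) : R :=
  - \sum_(a : A) fine (mu (xi @^-1` [set a])) * ln (fine (mu (xi @^-1` [set a]))).

(* [xi] labels the atoms of a finite partition; the fibres of [box_join act xi n]
   are the atoms of the join of its translates (act v)^-1 xi over all v in
   {0, ..., n-1}^m. *)
Definition box_join (m : nat) (T A : Type) (act : 'rV[int]_m -> T -> T)
    (xi : T -> A) (n : nat) (w : T) : {ffun {ffun 'I_m -> 'I_n} -> A} :=
  [ffun v : {ffun 'I_m -> 'I_n} => xi (act (\row_i (v i : nat)%:Z) w)].

Definition partition_rate d (T : measurableType d) (R : realType) (m : nat)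
    (act : 'rV[int]_m -> T -> T) (mu : probability T R)
    (A : finType) (xi : T -> A) : \bar R :=
  limn (fun n => (partition_entropy mu (box_join act xi n) / (n ^ m)%:R)%:E).

(* Kolmogorov-Sinai entropy of a Z^m-action: the supremum of the entropy rates
   of all finite measurable partitions. *)
Definition ks_entropy d (T : measurableType d) (R : realType) (m : nat)
    (act : 'rV[int]_m -> T -> T) (mu : probability T R) : \bar R :=
  ereal_sup [set h | exists (k : nat) (xi : T -> 'I_k),
    (forall i, measurable (xi @^-1` [set i])) /\ h = partition_rate act mu xi].

(* Main.v *)
Require Import Defs.
From mathcomp Require Import all_boot all_order all_algebra.
From mathcomp Require Import all_classical all_reals all_analysis.
From mathcomp Require Import measurable_realfun complex ring lra zify.

(** Fix a total order on Z^d invariant under translations (the lexicographic one).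
    By the chain rule and the concavity of [entropy2] it suffices to show that, given
    any pattern on finitely many earlier sites, the conditional probability of a 1 is
    at least GM(f), and that of a 0 at least GM(1 - f).  The second bound is the first
    one for the process with 0 and 1 exchanged.

    A conditional probability is a ratio of determinants, which Cramer's rule writes
    as (Q y)_0 for a vector y supported on the present and past sites.  Erasing the
    coordinates of y at the zeros of the pattern gives u with u_0 = 1 and
    u^* Q u <= (Q y)_0, because Q <= 1.  So it remains to see that
    r := u^* Q u >= GM(f) (the lower half of Szego's theorem).  In a large box of n^d
    sites, the probability of seeing only ones is at least GM(f)^(n^d): each eigenvalue
    of Q is the mean of f against a probability density, hence at least the exponential
    of the mean of log f, and these densities add up to the constant n^d.  On the other
    hand, revealing the sites in order, every site far from the boundary contributes a
    factor at most r, by the variational characterisation of the ratio of determinants.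
    Letting n go to infinity gives r >= GM(f). *)

Set Implicit Arguments.
Unset Strict Implicit.
Unset Printing Implicit Defensive.

Import Order.TTheory GRing.Theory Num.Theory.
Import numFieldNormedType.Exports.

Local Open Scope classical_set_scope.
Local Open Scope sesquilinear_scope.
Local Open Scope ring_scope.

(** * Conditioning patterns of a Hermitian matrix *)

Section Sesquilinear.
Variables (C : numClosedFieldType) (n : nat).
Implicit Types (Q : 'M[C]_n) (u v w : 'cV[C]_n).

Definition sform Q u v : C := (u ^t* *m Q *m v) 0 0.

Lemma sformE Q u v : sform Q u v = \sum_i (u i 0)^* * (Q *m v) i 0.
Proof. by rewrite /sform -mulmxA mxE; apply: eq_bigr => i _; rewrite !mxE. Qed.

Lemma sformEE Q u v : sform Q u v = \sum_i \sum_j (u i 0)^* * Q i j * v j 0.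
Proof.
rewrite sformE; apply: eq_bigr => i _; rewrite mxE mulr_sumr.
by apply: eq_bigr => j _; rewrite mulrA.
Qed.

Lemma sformDr Q u v w : sform Q u (v + w) = sform Q u v + sform Q u w.
Proof. by rewrite /sform mulmxDr mxE. Qed.

Lemma sformDl Q u v w : sform Q (u + v) w = sform Q u w + sform Q v w.
Proof. by rewrite /sform raddfD /= map_mxD !mulmxDl mxE. Qed.

Lemma sformC Q u v : Q ^t* = Q -> sform Q u v = (sform Q v u)^*.
Proof.
move=> hQ; rewrite !sformEE rmorph_sum exchange_big /=; apply: eq_bigr => i _.
rewrite rmorph_sum; apply: eq_bigr => j _.
have Qij : (Q i j)^* = Q j i by rewrite -{2}hQ !mxE.
by rewrite !rmorphM /= conjCK Qij -mulrA [RHS]mulrC [v i 0 * _]mulrC.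
Qed.

End Sesquilinear.

(** * Pattern determinants and Cramer's rule *)

Section Pattern.
Variable C : numClosedFieldType.

(** When [Q] is the correlation matrix of the sites, the determinant is the probability of the
    pattern [t]: by inclusion-exclusion, a zero is a row of [1 - Q]. *)
Definition pattern_mx n (Q : 'M[C]_n) (t : 'I_n -> bool) : 'M[C]_n :=
  \matrix_(i, j) if t i then Q i j else (i == j)%:R - Q i j.

(** A unit row leaves site 0 unconstrained without changing the size. The ratio of the determinants
    of [pattern_mx] and [pivot_mx] is thus the conditional probability of the value at site 0. *)
Definition pivot_mx n (Q : 'M[C]_n.+1) (t : 'I_n.+1 -> bool) : 'M[C]_n.+1 :=
  \matrix_(i, j) if i == 0 then (i == j)%:R else pattern_mx Q t i j.

Lemma det_pivot n (Q : 'M[C]_n.+1) t :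
  \det (pivot_mx Q t) =
  \det (pattern_mx (row' 0 (col' 0 Q)) (fun i => t (lift 0 i))).
Proof.
rewrite (expand_det_row _ 0) (bigD1 0) //= big1 ?addr0; last first.
  by move=> j jn0; rewrite !mxE eqxx eq_sym (negPf jn0) mul0r.
rewrite mxE !eqxx mul1r /cofactor expr0 mul1r; congr (\det _).
by apply/matrixP => i j; rewrite !mxE /=; case: (t _).
Qed.

Lemma row'_pivot n (Q : 'M[C]_n.+1) t t' : (forall i, t (lift 0 i) = t' (lift 0 i)) ->
  row' 0 (pattern_mx Q t) = row' 0 (pivot_mx Q t').
Proof. by move=> tt'; apply/matrixP => i j; rewrite !mxE tt'. Qed.

(** The rows 0 for a one and for a zero add up to the unit row, and the determinant is linear in row
    0. *)
Lemma det_pattern_split n (Q : 'M[C]_n.+1) t t1 t0 :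
  t1 0 = true -> t0 0 = false -> (forall i, t1 (lift 0 i) = t (lift 0 i)) ->
  (forall i, t0 (lift 0 i) = t (lift 0 i)) ->
  \det (pattern_mx Q t1) + \det (pattern_mx Q t0) = \det (pivot_mx Q t).
Proof.
move=> t10 t00 e1 e0.
rewrite (@determinant_multilinear _ _ (pivot_mx Q t) (pattern_mx Q t1) (pattern_mx Q t0) 0 1 1).
- by rewrite !mul1r.
- by apply/rowP => j; rewrite !mxE eqxx t10 t00 !mul1r addrC subrK.
- exact: row'_pivot.
- exact: row'_pivot.
Qed.

(** [y] solves the linear system of [pivot_mx Q t] with the first unit vector on the right; its rows
    say that [Q y] vanishes at the ones and agrees with [y] at the zeros. *)
Lemma pattern_cramer n (Q : 'M[C]_n.+1) (t : 'I_n.+1 -> bool) :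
  t 0 = true -> \det (pivot_mx Q t) != 0 ->
  exists y : 'cV[C]_n.+1, [/\ y 0 0 = 1,
   forall i, i != 0 -> (Q *m y) i 0 = if t i then 0 else y i 0 &
   \det (pattern_mx Q t) = \det (pivot_mx Q t) * (Q *m y) 0 0].
Proof.
move=> t0; set M0 := pivot_mx Q t => dM0.
(* Written through the adjugate, the coordinates of [y] are the cofactors along row 0, which
   [pattern_mx Q t] shares. *)
pose y := (\det M0)^-1 *: col 0 (\adj M0).
have M0y : M0 *m y = delta_mx 0 0.
  rewrite /y -scalemxAr colE mulmxA mul_mx_adj -scalemx1 -scalemxAl mul1mx.
  by rewrite scalerA mulVf // scale1r.
have y0 : y 0 0 = 1.
  move: (congr1 (fun A : 'cV[C]_n.+1 => A 0 0) M0y); rewrite mxE [RHS]mxE !eqxx.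
  rewrite (bigD1 0) //= big1 ?addr0 => [|j jn0]; first by rewrite mxE !eqxx mul1r.
  by rewrite mxE eqxx eq_sym (negPf jn0) mul0r.
exists y; split=> // [i in0|].
  have := congr1 (fun A : 'cV[C]_n.+1 => A i 0) M0y; rewrite mxE [RHS]mxE (negPf in0) /=.
  case: ifP => ti; first by move=> E;
    apply: etrans E; rewrite mxE; apply: eq_bigr => j _; rewrite !mxE (negPf in0) ti.
  under eq_bigr do rewrite !mxE (negPf in0) ti mulrBl.
  rewrite sumrB (bigD1 i) //= eqxx mul1r big1 ?addr0; last first.
    by move=> j ji; rewrite eq_sym (negPf ji) mul0r.
  move=> /eqP; rewrite subr_eq0 => /eqP E.
  have yE j : y j 0 = (\det M0)^-1 * cofactor M0 0 j by rewrite !mxE.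
  by rewrite mxE yE E; apply: eq_bigr => j _; rewrite yE.
rewrite (expand_det_row _ 0) mxE mulr_sumr; apply: eq_bigr => j _.
have yE : y j 0 = (\det M0)^-1 * cofactor M0 0 j by rewrite !mxE.
rewrite yE [RHS]mulrCA mulVKf // mxE t0 /cofactor.
by congr (_ * (_ * \det _)); apply/matrixP => i k; rewrite !mxE.
Qed.

(* Erase from the Cramer solution [y] the coordinates [z] of the zeros of the pattern:
   the form drops by [|z|^2 - z^* Q z], which is nonnegative because [Q <= 1]. *)
Lemma pattern_lower n (Q : 'M[C]_n.+1) (t : 'I_n.+1 -> bool) :
  Q ^t* = Q -> (forall z, sform Q z z <= sform 1%:M z z) ->
  t 0 = true -> 0 < \det (pivot_mx Q t) ->
  exists2 u : 'cV[C]_n.+1, u 0 0 = 1 &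
    \det (pivot_mx Q t) * sform Q u u <= \det (pattern_mx Q t).
Proof.
move=> hQ Q1 t0 dM0; have [|y [y0 Qy ->]] := pattern_cramer (Q := Q) t0; first by rewrite gt_eqF.
pose z : 'cV[C]_n.+1 := \col_i (if (i != 0) && ~~ t i then y i 0 else 0).
pose u := y - z.
have zE i : z i 0 = if (i != 0) && ~~ t i then y i 0 else 0 by rewrite mxE.
have uE i : u i 0 = if (i != 0) && ~~ t i then 0 else y i 0.
  by rewrite mxE mxE zE; case: ifP; rewrite ?subrr ?subr0.
have yE : y = u + z by rewrite subrK.
exists u; first by rewrite uE eqxx.
rewrite ler_pM2l //.
have uQy : sform Q u y = (Q *m y) 0 0.
  rewrite sformE (bigD1 0) //= uE eqxx y0 conjC1 mul1r big1 ?addr0 // => i in0.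
  by rewrite uE in0 Qy //=; case: (t i); rewrite /= ?mulr0 ?conjC0 ?mul0r.
have zQy : sform Q z y = sform 1%:M z z.
  rewrite !sformE; apply: eq_bigr => i _; rewrite mul1mx zE.
  by case: ifP => [/andP[in0 ti]|]; rewrite ?conjC0 ?mul0r // Qy // (negPf ti).
have zr : sform 1%:M z z = (sform 1%:M z z)^*.
  by rewrite {1}sformC // tr_scalar_mx map_scalar_mx /= conjC1.
have zQr : sform Q z z = (sform Q z z)^* by rewrite {1}sformC.
have uQz : sform Q u z = sform 1%:M z z - sform Q z z.
  rewrite sformC // zr zQr -rmorphB; congr (_ ^* ).
  by rewrite -zQy yE sformDr addrK.
by rewrite -uQy yE sformDr lerDl uQz subr_ge0.
Qed.

(** For the pattern of ones, [Q y] vanishes off site 0, so the Cramer solution [y] is orthogonal for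
    [Q] to every [v - y] with [v 0 0 = 1]. Hence [y] minimises the form among such [v]. *)
Lemma pattern_upper n (Q : 'M[C]_n.+1) (t : 'I_n.+1 -> bool) (v : 'cV[C]_n.+1) :
  Q ^t* = Q -> (forall z, 0 <= sform Q z z) ->
  (forall i, t i) -> 0 < \det (pivot_mx Q t) -> v 0 0 = 1 ->
  \det (pattern_mx Q t) <= \det (pivot_mx Q t) * sform Q v v.
Proof.
move=> hQ Q0 t1 dM0 v0; have dM0' : \det (pivot_mx Q t) != 0 by rewrite gt_eqF.
have [y [y0 Qy ->]] := pattern_cramer (t1 0) dM0'.
rewrite ler_pM2l //.
pose z := v - y; have vE : v = y + z by rewrite addrC subrK.
have z0 : z 0 0 = 0 by rewrite mxE mxE v0 y0 subrr.
have zQy : sform Q z y = 0.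
  rewrite sformE big1 // => i _; have [->|in0] := eqVneq i 0; first by rewrite z0 conjC0 mul0r.
  by rewrite Qy // t1 mulr0.
have yQy : sform Q y y = (Q *m y) 0 0.
  rewrite sformE (bigD1 0) //= y0 conjC1 mul1r big1 ?addr0 // => i in0.
  by rewrite Qy // t1 mulr0.
clearbody z; rewrite vE sformDr !sformDl zQy addr0 yQy lerDl.
by rewrite (sformC y z hQ) zQy conjC0 add0r.
Qed.
End Pattern.

(** The basis consists of the adjoints of the rows of the diagonalising unitary matrix. Eigenvalues
    appear as values of the form, ready for an integral formula; the last clause is Parseval's
    identity. *)
Lemma hermitian_eigenbasis (C : numClosedFieldType) n (Q : 'M[C]_n) : Q ^t* = Q ->
  exists u : 'I_n -> 'cV[C]_n,
    [/\ \det Q = \prod_i sform Q (u i) (u i),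
        forall i, sform 1%:M (u i) (u i) = 1 &
        forall v, \sum_i `|sform 1%:M (u i) v| ^+ 2 = sform 1%:M v v].
Proof.
move=> hQ; have /orthomx_spectralP : Q \is normalmx by apply/normalmxP; rewrite hQ.
have := spectral_unitarymx Q; set P := spectralmx Q; set D := spectral_diag Q => PU QE.
have PP : P *m P^t* = 1%:M := unitarymxP PU.
have PP' : P^t* *m P = 1%:M by move: (mulmx1C PP).
have uT i : ((row i P)^t*)^t* = row i P by rewrite trmxCK.
exists (fun i => (row i P)^t*).
have QD i : sform Q ((row i P)^t*) ((row i P)^t*) = D 0 i.
  rewrite /sform uT.
  have -> : (row i P *m Q *m (row i P)^t*) 0 0 = (P *m Q *m P^t*) i i.
    by rewrite -row_mul !mxE; apply: eq_bigr => k _; rewrite !mxE.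
  rewrite QE invmx_unitary // !mulmxA PP mul1mx -mulmxA PP mulmx1.
  by rewrite !mxE eqxx mulr1n.
split.
- rewrite {1}QE !det_mulmx det_inv mulrAC mulVf ?mul1r; last first.
    by rewrite -unitfE -unitmxE unitarymx_unit.
  by rewrite det_diag; apply: eq_bigr => i _ /=; rewrite QD.
- move=> i; rewrite /sform /= uT mulmx1.
  move: (congr1 (fun A : 'M[C]_n => A i i) PP); rewrite [RHS]mxE eqxx => E; apply: etrans E.
  by rewrite !mxE; apply: eq_bigr => k _; rewrite !mxE.
move=> v; transitivity (sform 1%:M (P *m v) (P *m v)).
  rewrite sformE; apply: eq_bigr => i _; rewrite mul1mx normCKC.
  rewrite /sform /= uT mulmx1.
  by congr (_^* * _); rewrite !mxE; apply: eq_bigr => k _; rewrite !mxE.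
by rewrite /sform !mulmx1 trmx_mul map_mxM mulmxA -(mulmxA _ _ P) PP' mulmx1.
Qed.

(** * Fourier coefficients on the torus *)

Section ProbabilityIntegral.
Context d (T : measurableType d) (R : realType) (P : probability T R).

Lemma integrable_le (g : T -> R) (M : R) :
  measurable_fun setT g -> (forall x, `|g x| <= M) -> P.-integrable setT (EFin \o g).
Proof.
move=> mg gM; apply: measurable_bounded_integrable => //.
  by rewrite /= probability_setT ltry.
exists M; split; first exact: num_real.
by move=> N MN x _ /=; apply: le_trans (gM x) (ltW MN).
Qed.

Lemma Rintegral_prob_cst (c : R) : \int[P]_x c = c.
Proof. by rewrite Rintegral_cst //= probability_setT mulr1. Qed.

End ProbabilityIntegral.

(** * Trigonometric integrals over one period *)

Section UniformIntegral.
Variable R : realType.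
Local Notation U := (uniform_prob (@ltr01 R)).

Lemma Rintegral_uniform_primitive (F g : R -> R) :
  (forall x : R, is_derive x (1 : R) F (g x)) -> continuous g -> (forall x, `|g x| <= 1) ->
  \int[U]_x g x = F 1 - F 0.
Proof.
move=> dF cg g1.
have mg : measurable_fun setT g by exact: continuous_measurable_fun.
have ig : U.-integrable setT (EFin \o g) by apply: (@integrable_le _ _ _ U g 1).
have ic : U.-integrable setT (EFin \o cst (1 : R)).
  by apply: (@integrable_le _ _ _ _ _ 1) => // x; rewrite /= normr1.
(* Adding 1 makes the integrand nonnegative, as [integral_uniform] requires. *)
suff : \int[U]_x (1 + g x) = 1 + (F 1 - F 0).
  by rewrite RintegralD // Rintegral_prob_cst => /addrI.
have c1g : continuous (fun x => 1 + g x).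
  by move=> x; apply: cvgD; [exact: cvg_cst|exact: cg].
rewrite /Rintegral integral_uniform; last 2 first.
- by apply/measurable_EFinP; exact: continuous_measurable_fun.
- move=> x; rewrite lee_fin -lerBlDl sub0r.
  by have := g1 x; rewrite ler_norml => /andP[].
pose G x := x + F x.
have dG (x : R) : is_derive x (1 : R) G (1 + g x) by apply: is_deriveD.
have cG : continuous G.
  by move=> x; apply/differentiable_continuous/derivable1_diffP; case: (dG x).
rewrite (@continuous_FTC2 _ _ G) //.
- by rewrite subr0 invr1 mul1e /G /= add0r addrA.
- exact: continuous_subspaceT.
- split; first by move=> x _; case: (dG x).
  + exact/cvg_at_right_filter/cG.
  + exact/cvg_at_left_filter/cG.
- by move=> x _; rewrite derive1E; case: (dG x).
Qed.

Lemma cos_int2pi (k : int) : cos (2 * pi * k%:~R) = 1 :> R.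
Proof.
have E n : cos (2 * pi * n%:R) = 1 :> R.
  elim: n => [|n IH]; first by rewrite mulr0 cos0.
  by rewrite -(natr1 n) mulrDr mulr1 [X in _ + X]mulr_natl cosD2pi.
by case: k => n; rewrite ?NegzE ?mulrNz ?mulrN ?cosN E.
Qed.

Lemma sin_int2pi (k : int) : sin (2 * pi * k%:~R) = 0 :> R.
Proof.
have E n : sin (2 * pi * n%:R) = 0 :> R.
  elim: n => [|n IH]; first by rewrite mulr0 sin0.
  by rewrite -(natr1 n) mulrDr mulr1 [X in _ + X]mulr_natl sinD2pi.
by case: k => n; rewrite ?NegzE ?mulrNz ?mulrN ?sinN E ?oppr0.
Qed.

Lemma Rintegral_uniform_cos (k : int) :
  \int[U]_x cos (2 * pi * k%:~R * x) = (k == 0)%:R.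
Proof.
have [->|k0] := eqVneq k 0.
  rewrite (@eq_Rintegral _ _ _ _ _ (cst 1)) ?Rintegral_prob_cst // => x _.
  by rewrite mulr0 mul0r cos0.
set a : R := 2 * pi * k%:~R.
have a0 : a != 0 by rewrite /a !mulf_neq0 ?pnatr_eq0 ?intr_eq0 // gt_eqF // pi_gt0.
have dF (x : R) : is_derive x (1 : R) (fun x => a^-1 * sin (a * x)) (cos (a * x)).
  apply: is_derive_eq.
  by rewrite /GRing.scale /= !mulr1 mulrC -mulrA mulfV ?mulr1.
rewrite (Rintegral_uniform_primitive dF).
- by rewrite mulr1 mulr0 sin0 sin_int2pi subrr.
- move=> x; apply: (@continuous_comp _ _ _ (fun x => a * x) (@cos R)).
    by apply: cvgMr; exact: cvg_id.
  exact: continuous_cos.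
- by move=> x; exact: cos_max.
Qed.

Lemma Rintegral_uniform_sin (k : int) : \int[U]_x sin (2 * pi * k%:~R * x) = 0.
Proof.
have [->|k0] := eqVneq k 0.
  rewrite (@eq_Rintegral _ _ _ _ _ (cst 0)) ?Rintegral_prob_cst // => x _.
  by rewrite mulr0 mul0r sin0.
set a : R := 2 * pi * k%:~R.
have a0 : a != 0 by rewrite /a !mulf_neq0 ?pnatr_eq0 ?intr_eq0 // gt_eqF // pi_gt0.
have dF (x : R) : is_derive x (1 : R) (fun x => - a^-1 * cos (a * x)) (sin (a * x)).
  apply: is_derive_eq.
  by rewrite /GRing.scale /= !mulr1 !mulNr mulrN opprK mulrC -mulrA mulfV ?mulr1.
rewrite (Rintegral_uniform_primitive dF).
- by rewrite mulr1 mulr0 cos0 cos_int2pi subrr.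
- move=> x; apply: (@continuous_comp _ _ _ (fun x => a * x) (@sin R)).
    by apply: cvgMr; exact: cvg_id.
  exact: continuous_sin.
- by move=> x; exact: sin_max.
Qed.

End UniformIntegral.

Section ProductIntegral.
Context d1 d2 (T1 : measurableType d1) (T2 : measurableType d2) (R : realType).
Variables (P1 : probability T1 R) (P2 : probability T2 R).

Lemma Rintegral_prod (g : T1 * T2 -> R) (M : R) :
  measurable_fun setT g -> (forall z, `|g z| <= M) ->
  \int[(P1 \x P2)%E]_z g z = \int[P1]_x \int[P2]_y g (x, y).
Proof.
move=> mg gM.
have ig : (P1 \x P2)%E.-integrable setT (EFin \o g).
  by apply: (@integrable_le _ _ _ ((P1 \x P2)%E : probability _ R) g M).
rewrite /Rintegral -(integral12_prod_meas1 ig); congr fine.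
apply: eq_integral => x _; rewrite /fubini_F fineK //.
apply: integrable_fin_num => //.
apply: (@integrable_le _ _ _ P2 (fun y => g (x, y)) M) => //.
exact: measurableT_comp mg (measurable_pair1 x).
Qed.

Lemma Rintegral_prodM (a : T1 -> R) (b : T2 -> R) :
  measurable_fun setT a -> measurable_fun setT b ->
  (forall x, `|a x| <= 1) -> (forall y, `|b y| <= 1) ->
  \int[(P1 \x P2)%E]_z (a z.1 * b z.2) = (\int[P1]_x a x) * (\int[P2]_y b y).
Proof.
move=> ma mb a1 b1; rewrite (@Rintegral_prod _ 1).
- rewrite -RintegralZr //; last by apply: (@integrable_le _ _ _ P1 a 1).
  apply: eq_Rintegral => x _ /=; rewrite RintegralZl //.
  by apply: (@integrable_le _ _ _ P2 b 1).
- apply: measurable_funM.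
    exact: measurableT_comp ma measurable_fst.
  exact: measurableT_comp mb measurable_snd.
- by move=> z; rewrite normrM -[1]mulr1; exact: ler_pM.
Qed.

End ProductIntegral.

(** * Orthogonality of the characters of the torus *)

Section Wave.
Variable R : realType.

Lemma dotZ_tuple_cons d (k : 'rV[int]_d.+1) (z : measurableTypeR R * d.-tuple R) :
  dotZ k (tuple_cons z) = (k ord0 ord0)%:~R * z.1 + dotZ (\row_i k ord0 (lift ord0 i)) z.2.
Proof.
rewrite /dotZ big_ord_recl tnth0; congr (_ + _).
by apply: eq_bigr => i _; rewrite tnthS mxE.
Qed.

Lemma measurable_dotZ d (k : 'rV[int]_d) : measurable_fun setT (@dotZ R d k).
Proof.
apply: measurable_sum => i; apply: measurable_funM => //.
exact: measurable_tnth.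
Qed.

Lemma measurable_cos_dotZ d (k : 'rV[int]_d) :
  measurable_fun setT (fun x => cos (2 * pi * @dotZ R d k x)).
Proof.
apply: (@measurableT_comp _ _ _ _ _ _ (@cos R)).
  by apply: continuous_measurable_fun; exact: continuous_cos.
by apply: measurable_funM => //; exact: measurable_dotZ.
Qed.

Lemma measurable_sin_dotZ d (k : 'rV[int]_d) :
  measurable_fun setT (fun x => sin (2 * pi * @dotZ R d k x)).
Proof.
apply: (@measurableT_comp _ _ _ _ _ _ (@sin R)).
  by apply: continuous_measurable_fun; exact: continuous_sin.
by apply: measurable_funM => //; exact: measurable_dotZ.
Qed.

Lemma Rintegral_torusS d (g : d.+1.-tuple R -> R) (M : R) :
  measurable_fun setT g -> (forall x, `|g x| <= M) ->
  \int[torus_measure R d.+1]_x g x =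
  \int[(uniform_prob (@ltr01 R) \x torus_measure R d)%E]_z g (tuple_cons z).
Proof.
move=> mg gM; rewrite /Rintegral /= integral_distribution //.
  exact/measurable_EFinP.
apply: (@integrable_le _ _ _
  ((uniform_prob (@ltr01 R) \x torus_measure R d)%E : probability _ R)
  (g \o @tuple_cons R d) M) => //.
  exact: measurableT_comp mg (@measurable_tuple_cons R d).
by move=> z; exact: gM.
Qed.

(** Induction on the dimension: the addition formulas and Fubini split off the first coordinate.
    Cosine and sine go together because the addition formulas mix them. *)
Lemma Rintegral_wave d (k : 'rV[int]_d) :
  \int[torus_measure R d]_x cos (2 * pi * dotZ k x) = (k == 0)%:R /\
  \int[torus_measure R d]_x sin (2 * pi * dotZ k x) = 0.
Proof.
elim: d k => [|d IH] k.
  have k0 : k = 0 by apply/rowP => -[].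
  have dot0 x : @dotZ R 0 k x = 0 by rewrite /dotZ big_ord0.
  split.
    under eq_Rintegral do rewrite dot0 mulr0 cos0.
    by rewrite Rintegral_prob_cst k0 eqxx.
  under eq_Rintegral do rewrite dot0 mulr0 sin0.
  by rewrite Rintegral_prob_cst.
set k' := \row_i k ord0 (lift ord0 i).
have keq : (k == 0) = (k ord0 ord0 == 0) && (k' == 0).
  apply/eqP/andP => [kz|[/eqP k0 /eqP k'0]].
    by split; apply/eqP; [rewrite kz mxE|apply/rowP => i; rewrite !mxE kz mxE].
  apply/rowP => i; rewrite mxE; case: (unliftP ord0 i) => [j ->|-> //].
  by move/rowP: k'0 => /(_ j); rewrite !mxE.
have [IHc IHs] := IH k'.
have E (z : measurableTypeR R * d.-tuple R) : 2 * pi * dotZ k (tuple_cons z) =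
    2 * pi * (k ord0 ord0)%:~R * z.1 + 2 * pi * dotZ k' z.2.
  by rewrite dotZ_tuple_cons mulrDr mulrA.
have mc (j : int) : measurable_fun setT (fun x : R => cos (2 * pi * j%:~R * x)).
  apply: continuous_measurable_fun => x; apply: (@continuous_comp _ _ _ _ (@cos R)).
    by apply: cvgMr; exact: cvg_id.
  exact: continuous_cos.
have ms (j : int) : measurable_fun setT (fun x : R => sin (2 * pi * j%:~R * x)).
  apply: continuous_measurable_fun => x; apply: (@continuous_comp _ _ _ _ (@sin R)).
    by apply: cvgMr; exact: cvg_id.
  exact: continuous_sin.
pose PP : probability _ R := (uniform_prob (@ltr01 R) \x torus_measure R d)%E.
have iM (a : R -> R) (b : d.-tuple R -> R) :
    measurable_fun setT a -> measurable_fun setT b ->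
    (forall x, `|a x| <= 1) -> (forall y, `|b y| <= 1) ->
    PP.-integrable setT (EFin \o (fun z => a z.1 * b z.2)).
  move=> ma mb a1 b1; apply: (@integrable_le _ _ _ _ _ 1).
    apply: measurable_funM.
      exact: measurableT_comp ma measurable_fst.
    exact: measurableT_comp mb measurable_snd.
  by move=> z; rewrite normrM -[1]mulr1; exact: ler_pM.
pose pM a b ma mb a1 b1 := @Rintegral_prodM _ _ _ _ _ (uniform_prob (@ltr01 R))
  (torus_measure R d) a b ma mb a1 b1.
split.
- rewrite (@Rintegral_torusS _ _ 1); last 2 first.
  + exact: measurable_cos_dotZ.
  + by move=> x; exact: cos_max.
  under eq_Rintegral do rewrite E cosD.
  rewrite (@RintegralB _ _ _ PP) //; last 2 first.
  + exact: (iM _ _ (mc _) (measurable_cos_dotZ k') (fun=> cos_max _) (fun=> cos_max _)).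
  + exact: (iM _ _ (ms _) (measurable_sin_dotZ k') (fun=> sin_max _) (fun=> sin_max _)).
  apply: etrans (f_equal2 (fun u v : R => u - v)
    (pM _ _ (mc _) (measurable_cos_dotZ k') (fun=> cos_max _) (fun=> cos_max _))
    (pM _ _ (ms _) (measurable_sin_dotZ k') (fun=> sin_max _) (fun=> sin_max _))) _.
  by rewrite Rintegral_uniform_cos Rintegral_uniform_sin IHc mul0r subr0 keq -natrM mulnb.
rewrite (@Rintegral_torusS _ _ 1); last 2 first.
- exact: measurable_sin_dotZ.
- by move=> x; exact: sin_max.
under eq_Rintegral do rewrite E sinD.
rewrite (@RintegralD _ _ _ PP) //; last 2 first.
- exact: (iM _ _ (ms _) (measurable_cos_dotZ k') (fun=> sin_max _) (fun=> cos_max _)).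
- exact: (iM _ _ (mc _) (measurable_sin_dotZ k') (fun=> cos_max _) (fun=> sin_max _)).
apply: etrans (f_equal2 (fun u v : R => u + v)
  (pM _ _ (ms _) (measurable_cos_dotZ k') (fun=> sin_max _) (fun=> cos_max _))
  (pM _ _ (mc _) (measurable_sin_dotZ k') (fun=> cos_max _) (fun=> sin_max _))) _.
by rewrite Rintegral_uniform_sin IHs mul0r mulr0 addr0.
Qed.

End Wave.

(** * Integrals of bounded complex functions *)

Section Cintegral.
Context d (T : measurableType d) (R : realType) (P : probability T R).

(** A class closed under sums and products whose members are integrable for every probability, so
    that integrability follows from the shape of the integrand. *)
Definition cbounded (g : T -> R[i]) :=
  [/\ measurable_fun setT (fun x => complex.Re (g x)),
      measurable_fun setT (fun x => complex.Im (g x)) &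
      exists M : R, forall x, `|complex.Re (g x)| <= M /\ `|complex.Im (g x)| <= M].

Lemma complex_ReM (z w : R[i]) :
  complex.Re (z * w) = complex.Re z * complex.Re w - complex.Im z * complex.Im w.
Proof. by case: z => a b; case: w => a' b'. Qed.

Lemma complex_ImM (z w : R[i]) :
  complex.Im (z * w) = complex.Re z * complex.Im w + complex.Im z * complex.Re w.
Proof. by case: z => a b; case: w => a' b'. Qed.

Lemma complex_ReD (z w : R[i]) : complex.Re (z + w) = complex.Re z + complex.Re w.
Proof. by case: z => a b; case: w => a' b'. Qed.

Lemma complex_ImD (z w : R[i]) : complex.Im (z + w) = complex.Im z + complex.Im w.
Proof. by case: z => a b; case: w => a' b'. Qed.

Lemma cbounded_cst c : cbounded (fun=> c).
Proof.
split=> //; exists (`|complex.Re c| + `|complex.Im c|) => x.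
by split; rewrite ?lerDl ?lerDr.
Qed.

Lemma cboundedD g h : cbounded g -> cbounded h -> cbounded (fun x => g x + h x).
Proof.
move=> [mg1 mg2 [M gM]] [mh1 mh2 [N hN]]; split.
- by under eq_fun do rewrite complex_ReD; exact: measurable_funD.
- by under eq_fun do rewrite complex_ImD; exact: measurable_funD.
exists (M + N) => x; have [? ?] := gM x; have [? ?] := hN x.
by rewrite complex_ReD complex_ImD; split; apply: le_trans (ler_normD _ _) _; exact: lerD.
Qed.

Lemma cboundedM g h : cbounded g -> cbounded h -> cbounded (fun x => g x * h x).
Proof.
move=> [mg1 mg2 [M gM]] [mh1 mh2 [N hN]]; split.
- by under eq_fun do rewrite complex_ReM; apply: measurable_funB; exact: measurable_funM.
- by under eq_fun do rewrite complex_ImM; apply: measurable_funD; exact: measurable_funM.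
exists (M * N + M * N) => x; have [? ?] := gM x; have [? ?] := hN x.
rewrite complex_ReM complex_ImM; split; first apply: le_trans (ler_normB _ _) _.
  by rewrite !normrM; apply: lerD; apply: ler_pM.
by apply: le_trans (ler_normD _ _) _; rewrite !normrM; apply: lerD; apply: ler_pM.
Qed.

Lemma cbounded_sum (I : Type) (s : seq I) (g : I -> T -> R[i]) :
  (forall i, cbounded (g i)) -> cbounded (fun x => \sum_(i <- s) g i x).
Proof.
move=> bg; elim: s => [|i s IH].
  by under eq_fun do rewrite big_nil; exact: cbounded_cst.
by under eq_fun do rewrite big_cons; exact: cboundedD.
Qed.

Lemma cbounded_integrable g : cbounded g ->
  P.-integrable setT (EFin \o (fun x => complex.Re (g x))) /\
  P.-integrable setT (EFin \o (fun x => complex.Im (g x))).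
Proof.
move=> [m1 m2 [M gM]].
by split; apply: (@integrable_le _ _ _ _ _ M) => // x; case: (gM x).
Qed.

Lemma eq_cintegral g h : g =1 h -> cintegral P g = cintegral P h.
Proof. by move=> gh; congr (cintegral P _); exact/funext. Qed.

Lemma cintegralD g h : cbounded g -> cbounded h ->
  cintegral P (fun x => g x + h x) = cintegral P g + cintegral P h.
Proof.
move=> /cbounded_integrable[? ?] /cbounded_integrable[? ?]; apply/eqP.
rewrite eq_complex complex_ReD complex_ImD /=; apply/andP; split; apply/eqP.
  by under eq_Rintegral do rewrite complex_ReD; exact: RintegralD.
by under eq_Rintegral do rewrite complex_ImD; exact: RintegralD.
Qed.

Lemma cintegralZ c g : cbounded g ->
  cintegral P (fun x => c * g x) = c * cintegral P g.
Proof.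
move=> /cbounded_integrable[ig1 ig2]; apply/eqP.
have Z (a : R) (h : T -> R) : P.-integrable setT (EFin \o h) ->
    P.-integrable setT (EFin \o (fun x => a * h x)).
  by move=> ih; apply: eq_integrable (integrableZl measurableT a ih) => // x _ /=; rewrite EFinM.
rewrite eq_complex complex_ReM complex_ImM /=; apply/andP; split; apply/eqP.
  under eq_Rintegral do rewrite complex_ReM.
  by rewrite RintegralB ?RintegralZl //; exact: Z.
under eq_Rintegral do rewrite complex_ImM.
by rewrite RintegralD ?RintegralZl //; exact: Z.
Qed.

Lemma cintegral_sum (I : Type) (s : seq I) (g : I -> T -> R[i]) :
  (forall i, cbounded (g i)) ->
  cintegral P (fun x => \sum_(i <- s) g i x) = \sum_(i <- s) cintegral P (g i).
Proof.
move=> bg; elim: s => [|i s IH].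
  rewrite big_nil (@eq_cintegral _ (fun=> 0)); last by move=> x; rewrite big_nil.
  by rewrite /cintegral /= Rintegral_prob_cst.
rewrite big_cons -IH -cintegralD //; last exact: cbounded_sum.
by apply: eq_cintegral => x; rewrite big_cons.
Qed.

Lemma cintegral_real (h : T -> R) : cintegral P (fun x => (h x)%:C%C) = (\int[P]_x h x)%:C%C.
Proof. by rewrite /cintegral /= Rintegral_prob_cst. Qed.

Lemma cintegral_conj g : cbounded g ->
  cintegral P (fun x => (g x)^*%R) = (cintegral P g)^*%R.
Proof.
move=> /cbounded_integrable[ig1 ig2]; apply/eqP.
rewrite eq_complex /=; apply/andP; split; apply/eqP.
  by apply: eq_Rintegral => x _; case: (g x).
rewrite -mulN1r -RintegralZl //.
by apply: eq_Rintegral => x _; rewrite mulN1r; case: (g x).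
Qed.

End Cintegral.

(** * Fourier coefficients and Gram matrices of characters *)

Section Fourier.
Variables (R : realType) (d : nat).
Local Notation mu := (torus_measure R d).

Lemma expiD (a b : R) : expi (a + b) = expi a * expi b.
Proof.
apply/eqP; rewrite eq_complex complex_ReM complex_ImM /= cosD sinD.
by rewrite [sin a * _ + _]addrC !eqxx.
Qed.

Lemma expi0 : expi (0 : R) = 1.
Proof. by rewrite /expi cos0 sin0. Qed.

Lemma conj_expi (a : R) : (expi a)^*%R = expi (- a).
Proof. by rewrite /expi cosN sinN. Qed.

Lemma dotZN (k : 'rV[int]_d) x : @dotZ R d (- k) x = - dotZ k x.
Proof.
by rewrite /dotZ -sumrN; apply: eq_bigr => i _; rewrite mxE mulrNz mulNr.
Qed.

Lemma dotZD (k l : 'rV[int]_d) x : @dotZ R d (k + l) x = dotZ k x + dotZ l x.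
Proof.
by rewrite /dotZ -big_split; apply: eq_bigr => i _; rewrite mxE intrD mulrDl.
Qed.

Definition wave (k : 'rV[int]_d) (x : d.-tuple R) : R[i] := expi (- (2 * pi * dotZ k x)).

Lemma waveD k l x : wave (k + l) x = wave k x * wave l x.
Proof. by rewrite /wave -expiD dotZD mulrDr opprD. Qed.

Lemma waveN k x : wave (- k) x = (wave k x)^*%R.
Proof. by rewrite /wave conj_expi dotZN mulrN. Qed.

Lemma cbounded_wave k : cbounded (wave k).
Proof.
rewrite /wave /expi; split => /=.
- by under eq_fun do rewrite cosN; exact: measurable_cos_dotZ.
- under eq_fun do rewrite sinN.
  by apply: measurableT_comp => //; exact: measurable_sin_dotZ.
- by exists 1 => x; split; [exact: cos_max|exact: sin_max].
Qed.

Section Density.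
Variable f : d.-tuple R -> R.
Hypotheses (mf : measurable_fun setT f) (f01 : forall x, 0 <= f x <= 1).

Lemma cbounded_density : cbounded (fun x => (f x)%:C%C).
Proof.
split=> //=; exists 1 => x; have /andP[f0 f1] := f01 x.
by rewrite normr0 ger0_norm.
Qed.

Lemma fourierE k : fourier f k = cintegral mu (fun x => (f x)%:C%C * wave k x).
Proof. by []. Qed.

Lemma fourier_conj k : fourier f (- k) = (fourier f k)^*%R.
Proof.
rewrite !fourierE -cintegral_conj; last first.
  by apply: cboundedM (cbounded_wave k); exact: cbounded_density.
by apply: eq_cintegral => x; rewrite rmorphM waveN; congr (_ * _); exact: esym (conjc_real _).
Qed.

End Density.

Lemma fourier_cst1 (k : 'rV[int]_d) : fourier (fun=> 1) k = (k == 0)%:R :> R[i].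
Proof.
have [Hc Hs] := Rintegral_wave R k.
rewrite fourierE /cintegral; apply/eqP.
have -> : (k == 0)%:R = Complex (k == 0)%:R 0 :> R[i] by case: eqP.
rewrite eq_complex /=; apply/andP; split; apply/eqP.
  by rewrite -Hc; apply: eq_Rintegral => x _; rewrite mul1r mul0r subr0 cosN.
have isin : mu.-integrable setT (EFin \o (fun x => sin (2 * pi * dotZ k x))).
  apply: (@integrable_le _ _ _ _ _ 1); first exact: measurable_sin_dotZ.
  by move=> x; exact: sin_max.
transitivity (-1 * \int[mu]_x sin (2 * pi * dotZ k x)); last by rewrite Hs mulr0.
rewrite -RintegralZl //.
by apply: eq_Rintegral => x _; rewrite mul1r mul0r addr0 sinN mulN1r.
Qed.

Lemma fourier_1B (f : d.-tuple R -> R) (k : 'rV[int]_d) :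
  measurable_fun setT f -> (forall x, 0 <= f x <= 1) ->
  fourier (fun x => 1 - f x) k = (k == 0)%:R - fourier f k.
Proof.
move=> mf f01; rewrite -fourier_cst1 !fourierE.
have b1 : cbounded (fun x : d.-tuple R => (1 : R)%:C%C * wave k x).
  by apply: cboundedM (cbounded_wave k); exact: cbounded_cst.
have bf : cbounded (fun x => (f x)%:C%C * wave k x).
  by apply: cboundedM (cbounded_wave k); exact: cbounded_density.
rewrite -mulN1r -cintegralZ // -cintegralD //; last first.
  by apply: cboundedM bf; exact: cbounded_cst.
apply: eq_cintegral => x.
by rewrite rmorphB /= mulrBl mulN1r.
Qed.

Section Gram.
Variables (f : d.-tuple R -> R) (n : nat) (e : 'I_n -> 'rV[int]_d).
Hypotheses (mf : measurable_fun setT f) (f01 : forall x, 0 <= f x <= 1).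

Definition gram : 'M[R[i]]_n := \matrix_(i, j) fourier f (e j - e i).

Lemma gram_hermitian : gram ^t* = gram.
Proof.
by apply/matrixP => i j; rewrite !mxE -fourier_conj // opprB.
Qed.

(** Conjugated, so that pairing with [u] gives the conjugate of the trigonometric polynomial with
    coefficients [u]. *)
Definition modes (x : d.-tuple R) : 'cV[R[i]]_n := \col_i (wave (e i) x)^*%R.

Definition csq (z : R[i]) : R := complex.Re z ^+ 2 + complex.Im z ^+ 2.

Lemma csqE z : (csq z)%:C%C = z^*%R * z.
Proof. by rewrite /csq add_Re2_Im2 normCKC. Qed.

Lemma cbounded_modes (u : 'cV[R[i]]_n) : cbounded (fun x => sform 1%:M u (modes x)).
Proof.
under eq_fun do rewrite sformE; apply: cbounded_sum => i.
apply: cboundedM; first exact: cbounded_cst.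
by under eq_fun do rewrite mul1mx mxE -waveN; exact: cbounded_wave.
Qed.

(** Expanding the squared modulus of the trigonometric polynomial of [u] produces the waves at the
    differences [e j - e i]. This formula yields [0 <= Q <= 1] and shows eigenvalues to be averages
    of [f]. *)
Lemma gram_form (u : 'cV[R[i]]_n) :
  sform gram u u = (\int[mu]_x (f x * csq (sform 1%:M u (modes x))))%:C%C.
Proof.
have bw i j : cbounded (fun x => (u i 0)^*%R * u j 0 * ((f x)%:C%C * wave (e j - e i) x)).
  apply: cboundedM; first exact: cbounded_cst.
  by apply: cboundedM (cbounded_wave _); exact: cbounded_density.
rewrite -cintegral_real sformEE.
transitivity (\sum_i \sum_j cintegral mu
    (fun x => (u i 0)^*%R * u j 0 * ((f x)%:C%C * wave (e j - e i) x))).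
  apply: eq_bigr => i _; apply: eq_bigr => j _.
  rewrite cintegralZ; last by apply: cboundedM (cbounded_wave _); exact: cbounded_density.
  by rewrite mxE fourierE mulrAC.
under eq_bigr => i _ do rewrite -cintegral_sum //.
rewrite -cintegral_sum; last by move=> i; exact: cbounded_sum.
apply: eq_cintegral => x; rewrite rmorphM /= csqE.
rewrite -normCKC normCK sformE.
under [in RHS]eq_bigr do rewrite mul1mx mxE.
rewrite rmorph_sum mulr_suml mulr_sumr; apply: eq_bigr => i _.
rewrite mulr_sumr mulr_sumr; apply: eq_bigr => j _.
rewrite waveD waveN rmorphM /= !conjCK.
ring.
Qed.

End Gram.
End Fourier.

(** * Determinants and the geometric mean *)

Section LogTangent.
Variable R : realType.
Implicit Types x c : R.

Lemma ln_tangent x c : 0 < x -> 0 < c -> ln x <= ln c + x / c - 1.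
Proof.
move=> x0 c0; have xc : 0 < x / c by rewrite divr_gt0.
have -> : x = c * (1 + (x / c - 1)) by field; rewrite gt_eqF.
rewrite lnM ?posrE //; last by rewrite addrC subrK.
have -> : c * (1 + (x / c - 1)) / c = x / c by field; rewrite gt_eqF.
by rewrite -addrA lerD2l; apply: le_ln1Dx; lra.
Qed.

(** The tangent of [ln] at [x], evaluated at [c] and multiplied by [x]. Summed over two probability
    vectors it becomes Gibbs' inequality; the case [x = 0] is covered by the multiplication by
    [x]. *)
Lemma xlnx_tangent x c : 0 <= x -> 0 < c -> x * ln c + x - c <= x * ln x.
Proof.
rewrite le_eqVlt => /predU1P[<-|x0] c0; first by rewrite !mul0r; lra.
have := ln_tangent c0 x0; rewrite -(ler_pM2l x0).
have -> : x * (ln x + c / x - 1) = x * ln x + c - x by field; rewrite gt_eqF.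
by lra.
Qed.

End LogTangent.

(** * Jensen's inequality for the logarithm *)

Section LogJensen.
Context d (T : measurableType d) (R : realType) (P : probability T R).
Variable f : T -> R.
Hypotheses (mf : measurable_fun setT f) (f01 : forall x, 0 <= f x <= 1).

(* Nonnegative, so that the integrals below compare without integrability
   hypotheses. *)
Definition neglog (x : T) : \bar R := (- lne (f x)%:E)%E.

Lemma neglog_ge0 x : (0 <= neglog x)%E.
Proof. by rewrite /neglog oppe_ge0 lne_le0 lee_fin; have /andP[] := f01 x. Qed.

Lemma measurable_neglog : measurable_fun setT neglog.
Proof.
apply: measurableT_comp => //.
apply: (@measurable_fun_ifT _ _ _ _ (fun=> -oo%E) (fun x => (ln (f x))%:E) (fun x => f x <= 0)).
- exact: measurable_fun_ler.
- exact: measurable_cst.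
- by apply/measurable_EFinP; exact: measurableT_comp.
Qed.

(** [GM] over an arbitrary probability space; for the torus measure the two are convertible. *)
Definition gm : R := fine (expeR (\int[P]_x lne (f x)%:E)).

(** Were the integral of [neglog] infinite, the exponential would be 0. *)
Lemma gm_gt0 : 0 < gm ->
  exists2 h : R, (\int[P]_x neglog x = h%:E)%E & 0 <= h /\ gm = expR (- h).
Proof.
have E : (\int[P]_x lne (f x)%:E = - \int[P]_x neglog x)%E.
  rewrite -integral_ge0N; last by move=> x _; exact: neglog_ge0.
  by apply: eq_integral => x _; rewrite /neglog oppeK.
have := @integral_ge0 _ _ _ P setT neglog (fun x _ => neglog_ge0 x).
rewrite /gm E; case: (\int[P]_x neglog x)%E => [h| |] //=.
- by rewrite lee_fin => h0 _; exists h.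
- by rewrite ltxx.
Qed.

Definition weight (c : T -> R) := [/\ measurable_fun setT c, forall x, 0 <= c x,
  exists M, forall x, `|c x| <= M & \int[P]_x c x = 1].

Lemma weight_integrable c : weight c -> P.-integrable setT (EFin \o c) /\
  P.-integrable setT (EFin \o (fun x => f x * c x)).
Proof.
move=> [mc c0 [M cM] _]; split; first exact: (@integrable_le _ _ _ P c M).
apply: (@integrable_le _ _ _ P _ M); first exact: measurable_funM.
move=> x; rewrite normrM -[M]mul1r; apply: ler_pM => //.
by have /andP[? ?] := f01 x; rewrite ger0_norm.
Qed.

(** Jensen's inequality before optimising the point of tangency [t]: the mean of [f] under [c] is
    the optimal choice, while another [t] serves to show that this mean is not 0. *)
Lemma neglog_tangent c t : weight c -> 0 < t -> t <= 1 ->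
  ((1 - ln t - (\int[P]_x (f x * c x)) / t)%:E <= \int[P]_x ((c x)%:E * neglog x))%E.
Proof.
move=> wc t0 t1; have [ic ifc] := weight_integrable wc; have [mc c0 _ c1] := wc.
have lt0 : 0 <= 1 - ln t by rewrite subr_ge0; apply: le_trans (ln_le0 t1) ler01.
have fE (h : T -> R) : P.-integrable setT (EFin \o h) ->
    (\int[P]_x (h x)%:E = (\int[P]_x h x)%:E)%E.
  by move=> ih; rewrite /Rintegral fineK //; exact: integrable_fin_num.
have mcg : measurable_fun setT (fun x => (c x)%:E * neglog x)%E.
  by apply: emeasurable_funM; [exact/measurable_EFinP|exact: measurable_neglog].
have cg0 x : (0 <= (c x)%:E * neglog x)%E.
  by apply: mule_ge0; [rewrite lee_fin|exact: neglog_ge0].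
have mfc : measurable_fun setT (fun x => (t^-1 * (f x * c x))%:E).
  apply/measurable_EFinP; apply: measurable_funM => //.
  exact: measurable_funM.
have fc0 x : 0 <= t^-1 * (f x * c x).
  apply: mulr_ge0; first by rewrite invr_ge0 ltW.
  by apply: mulr_ge0 => //; have /andP[] := f01 x.
(* With the term in [f / t] on the right and [t <= 1], both integrands are nonnegative. *)
have : (\int[P]_x (((1 - ln t) * c x)%:E) <=
        \int[P]_x ((c x)%:E * neglog x + (t^-1 * (f x * c x))%:E))%E.
  apply: ge0_le_integral => //.
  - by move=> x _; rewrite lee_fin mulr_ge0.
  - by apply/measurable_EFinP; exact: measurable_funM.
  - exact: emeasurable_funD.
  move=> x _; rewrite /neglog /=; have /andP[f0 f1] := f01 x.
  move: f0; rewrite le_eqVlt => /predU1P[<-|fx0].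
    (* Where [f] vanishes, [neglog] is infinite: the right side is infinite, or both sides are 0 if
       the weight vanishes too. *)
    rewrite lexx mul0r mulr0 adde0 [(- -oo)%E]/=.
    have := c0 x; rewrite le_eqVlt => /predU1P[<-|cx0]; first by rewrite mulr0 mul0e lexx.
    by rewrite gt0_muley ?lte_fin // leey.
  rewrite [(f x <= 0)%R]leNgt fx0 /= -EFinM -EFinD lee_fin.
  have := ln_tangent fx0 t0 => /(ler_wpM2l (c0 x)); rewrite -subr_ge0 => H.
  rewrite -subr_ge0; apply: le_trans H _; rewrite le_eqVlt; apply/orP; left; apply/eqP.
  by field; rewrite gt_eqF.
rewrite ge0_integralD //; last by move=> x _; rewrite lee_fin.
rewrite !fE; first last.
- by apply: eq_integrable (integrableZl measurableT (1 - ln t) ic) => // x _; rewrite /= EFinM.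
- by apply: eq_integrable (integrableZl measurableT (t^-1) ifc) => // x _; rewrite /= EFinM.
rewrite !RintegralZl // c1 mulr1.
case: (\int[P]_x ((c x)%:E * neglog x))%E => [r| |] //=.
- by rewrite -EFinD !lee_fin -lerBlDr [t^-1 * _]mulrC.
- by move=> _; exact: leey.
Qed.

(** Jensen bounds minus the logarithm of each factor by the integral of [neglog] against [c i]. As
    the weights add up to [n], these integrals add up to [n] times that of [neglog]. *)
Lemma gm_prod_le n (c : 'I_n -> T -> R) : 0 < gm -> (forall i, weight (c i)) ->
  (forall x, \sum_i c i x = n%:R) ->
  gm ^+ n <= \prod_i \int[P]_x (f x * c i x).
Proof.
move=> /gm_gt0[h hE [h0 ->]] wc sc.
have mcg i : measurable_fun setT (fun x => (c i x)%:E * neglog x)%E.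
  have [mc _ _ _] := wc i.
  by apply: emeasurable_funM; [exact/measurable_EFinP|exact: measurable_neglog].
have cg0 i x : (0 <= (c i x)%:E * neglog x)%E.
  have [_ c0 _ _] := wc i.
  by apply: mule_ge0; [rewrite lee_fin|exact: neglog_ge0].
have I0 i : (0 <= \int[P]_x ((c i x)%:E * neglog x))%E by apply: integral_ge0.
have sumI : (\sum_i \int[P]_x ((c i x)%:E * neglog x) = (n%:R * h)%:E)%E.
  rewrite -ge0_integral_sum // EFinM -hE -ge0_integralZl //; first last.
  - by move=> x _; exact: neglog_ge0.
  - exact: measurable_neglog.
  apply: eq_integral => x _; rewrite -(sc x) -sumEFin ge0_sume_distrl // => i _.
  by have [_ c0 _ _] := wc i; rewrite lee_fin.
have Ile i : (\int[P]_x ((c i x)%:E * neglog x) <= (n%:R * h)%:E)%E.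
  by rewrite -sumI (bigD1 i) //= leeDl // sume_ge0.
pose l i := \int[P]_x (f x * c i x).
have l0 i : 0 <= l i.
  apply: Rintegral_ge0 => x _; have [_ c0 _ _] := wc i.
  by rewrite mulr_ge0 //; have /andP[] := f01 x.
have l1 i : l i <= 1.
  have [ic ifc] := weight_integrable (wc i); have [_ c0 _ <-] := wc i.
  apply: le_Rintegral => // x _; rewrite ler_piMl //.
  by have /andP[] := f01 x.
have lgt0 i : 0 < l i.
  rewrite lt_neqAle l0 andbT eq_sym; apply/negP => /eqP li0.
  (* If [l i] were 0, the tangent inequality at this [t] would read [1 + n h <= n h]. *)
  pose t := expR (- (n%:R * h)).
  have t1 : t <= 1 by rewrite -expR0 ler_expR oppr_le0 mulr_ge0.
  have := le_trans (neglog_tangent (wc i) (expR_gt0 _) t1) (Ile i).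
  by rewrite -/(l i) li0 mul0r subr0 expRK lee_fin; lra.
have lnl i : ((- ln (l i))%:E <= \int[P]_x ((c i x)%:E * neglog x))%E.
  apply: le_trans (neglog_tangent (wc i) (lgt0 i) (l1 i)).
  by rewrite -/(l i) divff ?gt_eqF // lee_fin; lra.
have -> : \prod_i \int[P]_x (f x * c i x) = expR (\sum_i ln (l i)).
  by rewrite expR_sum; apply: eq_bigr => i _; rewrite lnK ?posrE.
rewrite -expRM_natl ler_expR mulrN lerNl -sumrN -lee_fin -sumI -sumEFin.
exact: lee_sum.
Qed.

End LogJensen.

(** * Bounds on Gram matrices and their determinants *)

Section GramBounds.
Variables (R : realType) (d : nat).
Local Notation mu := (torus_measure R d).

Lemma csq_ge0 (z : R[i]) : 0 <= csq z.
Proof. by rewrite addr_ge0 // sqr_ge0. Qed.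

Lemma gram_cst1 n (e : 'I_n -> 'rV[int]_d) : injective e ->
  gram (fun=> 1 : R) e = 1%:M.
Proof.
move=> ie; apply/matrixP => i j.
by rewrite !mxE fourier_cst1 subr_eq0 (inj_eq ie) eq_sym.
Qed.

Lemma gram_1B n (f : d.-tuple R -> R) (e : 'I_n -> 'rV[int]_d) :
  measurable_fun setT f -> (forall x, 0 <= f x <= 1) -> injective e ->
  gram (fun x => 1 - f x) e = 1%:M - gram f e.
Proof.
move=> mf f01 ie; apply/matrixP => i j.
by rewrite !mxE fourier_1B // subr_eq0 (inj_eq ie) eq_sym.
Qed.

Lemma range_1B (f : d.-tuple R -> R) : (forall x, 0 <= f x <= 1) ->
  forall x, 0 <= 1 - f x <= 1.
Proof. by move=> f01 x; have /andP[? ?] := f01 x; rewrite subr_ge0 gerBl; apply/andP. Qed.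

Variable f : d.-tuple R -> R.
Hypotheses (mf : measurable_fun setT f) (f01 : forall x, 0 <= f x <= 1).

Lemma gram_ge0 n (e : 'I_n -> 'rV[int]_d) u : 0 <= sform (gram f e) u u.
Proof.
rewrite gram_form // ler0c; apply: Rintegral_ge0 => x _.
by apply: mulr_ge0 (csq_ge0 _); have /andP[] := f01 x.
Qed.

Lemma sform_modes n (e : 'I_n -> 'rV[int]_d) (x : d.-tuple R) :
  sform 1%:M (modes e x) (modes e x) = n%:R.
Proof.
have wave0 : wave 0 x = 1 :> R[i].
  by rewrite /wave /dotZ big1 ?mulr0 ?oppr0 ?expi0 // => j _; rewrite mxE mul0r.
rewrite sformE (eq_bigr (fun=> 1)) => [|i _]; last first.
  by rewrite mul1mx mxE conjCK -waveN -waveD subrr.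
by rewrite sumr_const card_ord.
Qed.

Lemma gram_det_ge n (e : 'I_n -> 'rV[int]_d) : injective e -> 0 < GM f ->
  ((GM f ^+ n)%:C%C : R[i]) <= \det (gram f e).
Proof.
move=> ie Mf; have [u [-> u1 uv]] := hermitian_eigenbasis (gram_hermitian e mf f01).
pose c i x := csq (sform 1%:M (u i) (modes e x)).
have one01 (x : d.-tuple R) : 0 <= (1 : R) <= 1 by rewrite ler01 lexx.
have wc i : weight mu (c i).
  have [m1 m2 [M b12]] := cbounded_modes e (u i).
  split.
  - by apply: measurable_funD; exact: measurable_funX.
  - by move=> x; exact: csq_ge0.
  - exists (M ^+ 2 + M ^+ 2) => x; rewrite ger0_norm ?csq_ge0 //.
    have sqM (a : R) : `|a| <= M -> a ^+ 2 <= M ^+ 2.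
      by move=> aM; rewrite -real_normK ?num_real // lerXn2r ?nnegrE // (le_trans _ aM).
    by have [? ?] := b12 x; apply: lerD; exact: sqM.
  (* The total mass comes from the integral formula for the constant 1, whose Gram matrix is the
     identity. *)
  - have := gram_form e (@measurable_cst _ _ _ _ setT (1 : R)) one01 (u i).
    rewrite gram_cst1 // u1 => /complexI ->.
    by apply: eq_Rintegral => x _; rewrite mul1r.
(* Parseval's identity for the vector of waves at [x], all of modulus 1. *)
have sc x : \sum_i c i x = n%:R.
  apply: (@complexI R); rewrite rmorph_nat rmorph_sum -(sform_modes e x) -uv.
  by apply: eq_bigr => i _; rewrite /= csqE normCKC.
have := gm_prod_le mf f01 Mf wc sc; rewrite -lecR rmorph_prod.
by move=> /le_trans; apply; rewrite le_eqVlt; apply/orP; left; apply/eqP;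
  apply: eq_bigr => i _; rewrite gram_form.
Qed.

End GramBounds.

(** The Gram matrix of [1 - f] at distinct sites is [1 - Q], and its form is nonnegative. *)
Lemma gram_le1 (R : realType) d (f : d.-tuple R -> R) n (e : 'I_n -> 'rV[int]_d) u :
  measurable_fun setT f -> (forall x, 0 <= f x <= 1) -> injective e ->
  sform (gram f e) u u <= sform 1%:M u u.
Proof.
move=> mf f01 ie.
have m1f : measurable_fun setT (fun x => 1 - f x) by exact: measurable_funB.
have := gram_ge0 m1f (range_1B f01) e u.
have -> : gram (fun x => 1 - f x) e = 1%:M - gram f e by exact: gram_1B.
by rewrite /sform mulmxBr mulmxBl mxE [X in _ + X]mxE subr_ge0.
Qed.

(** * Determinants and forms on finite lists of sites *)

Section SeqGram.
Variables (R : realType) (d : nat) (f : d.-tuple R -> R).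
Implicit Types (s : seq 'rV[int]_d) (t : bitseq) (v : 'rV[int]_d).

Definition seq_gram s : 'M[R[i]]_(size s) := gram f (fun i : 'I_(size s) => nth 0 s i).

Definition pattern_det s t : R[i] :=
  \det (pattern_mx (seq_gram s) (fun i => nth false t i)).

(** The form on functions of the sites instead of on vectors indexed by positions, so that it can be
    compared between lists and translated. *)
Definition quad s (c : 'rV[int]_d -> R[i]) : R[i] :=
  \sum_(x <- s) \sum_(y <- s) (c x)^*%R * fourier f (y - x) * c y.

Lemma quad_sform s c :
  sform (seq_gram s) (\col_i c (nth 0 s i)) (\col_i c (nth 0 s i)) = quad s c.
Proof.
rewrite sformEE /quad (big_nth 0) big_mkord; apply: eq_bigr => i _.
rewrite (big_nth 0) big_mkord; apply: eq_bigr => j _.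
by rewrite !mxE.
Qed.

Lemma sum_sub_seq (T : eqType) (V : nmodType) (s s' : seq T) (F : T -> V) :
  uniq s -> uniq s' -> {subset s' <= s} -> (forall x, x \notin s' -> F x = 0) ->
  \sum_(x <- s) F x = \sum_(x <- s') F x.
Proof.
move=> us us' ss' F0; rewrite (bigID (mem s')) /= [X in _ + X]big1 // addr0 -big_filter.
apply: perm_big; apply: uniq_perm => //; first exact: filter_uniq.
by move=> x; rewrite mem_filter andb_idr //; exact: ss'.
Qed.

Lemma quad_sub s s' c : uniq s -> uniq s' -> {subset s' <= s} ->
  (forall x, x \notin s' -> c x = 0) -> quad s c = quad s' c.
Proof.
move=> us us' ss' c0; rewrite /quad (sum_sub_seq us us' ss'); last first.
  by move=> x xs; rewrite big1 // => y _; rewrite c0 // conjC0 !mul0r.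
apply: eq_bigr => x _; apply: sum_sub_seq => // y ys.
by rewrite (c0 y) // mulr0.
Qed.

Lemma quad_translate s c w : quad (map (+%R w) s) c = quad s (fun x => c (w + x)).
Proof.
rewrite /quad big_map; apply: eq_bigr => x _; rewrite big_map; apply: eq_bigr => y _.
by rewrite opprD addrACA subrr add0r.
Qed.

Lemma eq_quad s c c' : {in s, c =1 c'} -> quad s c = quad s c'.
Proof.
move=> cc'; apply: eq_big_seq => x xs; apply: eq_big_seq => y ys.
by rewrite !cc'.
Qed.

Lemma nth_inj_uniq s : uniq s -> injective (fun i : 'I_(size s) => nth 0 s i).
Proof. by move=> us i j /eqP; rewrite nth_uniq // => /eqP/val_inj. Qed.

Lemma seq_gram_cons v s : row' 0 (col' 0 (seq_gram (v :: s))) = seq_gram s.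
Proof. by apply/matrixP => i j; rewrite !mxE. Qed.

Lemma pattern_det_pivot v s b t :
  \det (pivot_mx (seq_gram (v :: s)) (fun i => nth false (b :: t) i)) = pattern_det s t.
Proof. by rewrite det_pivot seq_gram_cons. Qed.

Lemma pattern_det_cons v s t :
  pattern_det (v :: s) (true :: t) + pattern_det (v :: s) (false :: t) = pattern_det s t.
Proof.
by rewrite -(pattern_det_pivot v s true); apply: (@det_pattern_split _ (size s)).
Qed.

(** The dimension is a variable with an equation, so that it can be substituted: a list and its
    translate have sizes that are equal but not convertible. *)
Lemma pattern_det_eq_size s t n (g : 'I_n -> 'rV[int]_d) w : n = size s ->
  (forall i : 'I_n, g i = nth 0 s i + w) ->
  \det (pattern_mx (gram f g) (fun i => nth false t i)) = pattern_det s t.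
Proof.
move=> e; subst n => gE; have E : gram f g = seq_gram s.
  by apply/matrixP => i j; rewrite !mxE !gE opprD addrACA subrr addr0.
by rewrite E.
Qed.

Lemma pattern_det_translate s w t : pattern_det (map (+%R w) s) t = pattern_det s t.
Proof.
rewrite {1}/pattern_det {1}/seq_gram.
apply: (@pattern_det_eq_size s t (size (map (+%R w) s)) _ w); first exact: size_map.
move=> i; rewrite (nth_map 0) 1?addrC //.
exact: leq_trans (ltn_ord i) (eq_leq (size_map _ _)).
Qed.

End SeqGram.

Lemma complex_gt0 (R : realType) (x : R) : (0 < x%:C%C) = (0 < x).
Proof. by rewrite -[0](rmorph0 (real_complex R)) ltcR. Qed.

(* [p] is kept abstract because it is used twice: for the process of [f], and,
   after exchanging 0 and 1, for that of [1 - f]. *)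
Section PatternProb.
Variables (R : realType) (d : nat) (f : d.-tuple R -> R).
Hypotheses (mf : measurable_fun setT f) (f01 : forall x, 0 <= f x <= 1).
Variable p : seq 'rV[int]_d -> bitseq -> R.
Hypothesis pE : forall s t, uniq s -> size t = size s -> (p s t)%:C%C = pattern_det f s t.
Hypothesis p0 : forall s t, 0 <= p s t.
Implicit Types (s : seq 'rV[int]_d) (t : bitseq) (v : 'rV[int]_d).

Lemma quad_real s c : exists2 r : R, quad f s c = r%:C%C & 0 <= r.
Proof.
rewrite -quad_sform.
have := gram_ge0 mf f01 (fun i : 'I_(size s) => nth 0 s i) (\col_i c (nth 0 s i)).
by rewrite gram_form // ler0c; eexists; first by [].
Qed.

Lemma prob_cons v s t : uniq (v :: s) -> size t = size s ->
  p (v :: s) (true :: t) + p (v :: s) (false :: t) = p s t.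
Proof.
move=> uvs st; have /andP[_ us] := uvs.
by apply: complexI; rewrite rmorphD /= !pE //= ?st // pattern_det_cons.
Qed.

Lemma prob_true_ge v s t : uniq (v :: s) -> size t = size s -> 0 < p s t ->
  exists2 c, c v = 1 & (p s t)%:C%C * quad f (v :: s) c <= (p (v :: s) (true :: t))%:C%C.
Proof.
move=> uvs st pst; have /andP[vs us] := uvs.
have := @pattern_lower R[i] (size s) (seq_gram f (v :: s)) (fun i => nth false (true :: t) i).
rewrite pattern_det_pivot -pE //.
case.
- exact: gram_hermitian.
- by move=> z; apply: gram_le1 => //; exact: (nth_inj_uniq uvs).
- by [].
- by rewrite complex_gt0.
move=> u u0 H.
(* The vector becomes a function of sites by reading it at the position of the site in the list. *)
pose c x : R[i] := u (inord (index x (v :: s))) 0.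
exists c; first by rewrite /c /= eqxx (_ : inord 0 = 0) //; apply: val_inj; rewrite /= inordK.
rewrite [X in _ <= X]pE /= ?st //.
rewrite -quad_sform (_ : \col_i _ = u); first exact: H.
apply/matrixP => i j; rewrite !mxE ord1 /c; congr (u _ 0).
by rewrite index_uniq // inord_val.
Qed.

Lemma prob_ones_le v s c : uniq (v :: s) -> c v = 1 ->
  (p (v :: s) (nseq (size s).+1 true))%:C%C <=
  (p s (nseq (size s) true))%:C%C * quad f (v :: s) c.
Proof.
move=> uvs cv; have /andP[vs us] := uvs.
(* If the ones on [s] have probability 0, there is no conditional probability; then the left side is
   0 as well, since a longer pattern is less likely. *)
have := p0 s (nseq (size s) true); rewrite le_eqVlt => /predU1P[ps|ps].
  rewrite -ps mul0r lecR ps -(prob_cons uvs) ?size_nseq //= lerDl; exact: p0.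
rewrite [X in X <= _]pE ?size_nseq // [X in X * _]pE ?size_nseq //.
rewrite -(pattern_det_pivot f v s true (nseq (size s) true)) -quad_sform.
apply: (@pattern_upper R[i] (size s) (seq_gram f (v :: s))
  (fun i => nth false (true :: nseq (size s) true) i)).
- exact: gram_hermitian.
- by move=> z; exact: gram_ge0.
- by move=> i; rewrite -[true :: _]/(nseq (size s).+1 true) nth_nseq ltn_ord.
- by rewrite pattern_det_pivot -pE ?size_nseq // complex_gt0.
- by rewrite mxE.
Qed.

Lemma prob_ones_ge s : uniq s -> 0 < GM f -> GM f ^+ size s <= p s (nseq (size s) true).
Proof.
move=> us gf; rewrite -lecR [X in _ <= X]pE ?size_nseq //.
have := gram_det_ge mf f01 (nth_inj_uniq us) gf; congr (_ <= \det _).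
by apply/matrixP => i j; rewrite !mxE nth_nseq ltn_ord.
Qed.

Lemma GM_le1 : 0 < GM f -> GM f <= 1.
Proof.
by move=> /(gm_gt0 f01)[h _ [h0 E]]; rewrite [GM f]E -expR0 ler_expR oppr_le0.
Qed.

End PatternProb.

(** * The lower half of Szego's theorem *)

Section Lex.
Variable d : nat.
Implicit Types x y z w : 'rV[int]_d.

Definition lexlt x y : bool :=
  [exists i, (x ord0 i < y ord0 i) && [forall j : 'I_d, (j < i)%N ==> (x ord0 j == y ord0 j)]].

Lemma lexltP x y : reflect (exists2 i, x ord0 i < y ord0 i &
    forall j : 'I_d, (j < i)%N -> x ord0 j = y ord0 j) (lexlt x y).
Proof.
apply: (iffP existsP) => [[i /andP[xy /forallP h]]|[i xy h]]; exists i => //.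
  by move=> j ji; have := h j; rewrite ji => /eqP.
by rewrite xy; apply/forallP => j; apply/implyP => /h ->.
Qed.

Lemma lexlt_irr x : lexlt x x = false.
Proof. by apply/lexltP => -[k]; rewrite ltxx. Qed.

Lemma lexlt_trans : transitive lexlt.
Proof.
move=> y x z /lexltP[i xy hi] /lexltP[k yz hk]; apply/lexltP.
case: (ltngtP i k) => [ik|ki|/val_inj ik].
- exists i; first by rewrite -hk.
  by move=> j ji; rewrite hi // hk // (ltn_trans ji).
- exists k; first by rewrite hi.
  by move=> j jk; rewrite -hk // hi // (ltn_trans jk).
- by subst k; exists i; [exact: lt_trans yz|move=> j ji; rewrite hi // hk].
Qed.

Lemma lexlt_total x y : x != y -> lexlt x y || lexlt y x.
Proof.
move=> xy; have [i xi] : exists i, x ord0 i != y ord0 i.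
  apply/existsP; apply: contra_neqT xy; rewrite negb_exists => /forallP h.
  by apply/rowP => i; have := h i; rewrite negbK => /eqP.
case: (@arg_minnP _ i (fun i => x ord0 i != y ord0 i) (fun i => i : nat) xi) => k xk hk.
have h (j : 'I_d) : (j < k)%N -> x ord0 j = y ord0 j.
  by move=> jk; apply/eqP; apply: contraTT jk => xj; rewrite -leqNgt hk.
have [lt|gt|E] := ltgtP (x ord0 k) (y ord0 k).
- by apply/orP; left; apply/lexltP; exists k.
- by apply/orP; right; apply/lexltP; exists k => // j /h.
- by rewrite E eqxx in xk.
Qed.

Lemma lexltD w x y : lexlt (w + x) (w + y) = lexlt x y.
Proof.
apply/lexltP/lexltP => -[i xy h]; exists i.
- by move: xy; rewrite !mxE ltrD2l.
- by move=> j /h; rewrite !mxE => /addrI.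
- by rewrite !mxE ltrD2l.
- by move=> j /h ji; rewrite !mxE ji.
Qed.

Definition box n : seq 'rV[int]_d :=
  [seq \row_i (v i : nat)%:Z | v : {ffun 'I_d -> 'I_n}].

Lemma mem_box n x : (x \in box n) = [forall i, 0 <= x ord0 i < n%:Z].
Proof.
apply/mapP/forallP => [[v _ ->] i|h]; first by rewrite mxE ltz_nat ltn_ord andbT.
have h' i : (`|x ord0 i|%N < n)%N by have := h i; lia.
exists [ffun i => Ordinal (h' i)]; first by rewrite mem_enum.
by apply/rowP => i; rewrite mxE ffunE /= gez0_abs //; have /andP[] := h i.
Qed.

Lemma box_uniq n : uniq (box n).
Proof.
rewrite map_inj_uniq ?enum_uniq // => v w /rowP vw; apply/ffunP => i.
by apply: val_inj; have := vw i; rewrite !mxE => -[].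
Qed.

Lemma size_box n : size (box n) = (n ^ d)%N.
Proof. by rewrite size_map -cardE card_ffun !card_ord. Qed.

(** With the largest site first, the tail of each suffix is the past of its head inside the box, so
    revealing a site is a [cons]. *)
Lemma box_descending n : exists2 L, perm_eq L (box n) & pairwise (fun x y => lexlt y x) L.
Proof.
(* Sorting uses the reflexive order, which is total; strictness returns because the box has no
   repetitions. *)
pose ge x y := (x == y) || lexlt y x.
have tge : total ge.
  move=> x y; rewrite /ge [y == x]eq_sym; case: eqVneq => //= xy.
  by rewrite orbC lexlt_total.
have trge : transitive ge.
  move=> y x z /orP[/eqP->//|yx] /orP[/eqP<-|zy]; apply/orP; right => //.
  exact: lexlt_trans zy yx.
exists (sort ge (box n)); first by rewrite perm_sort.
have := sort_sorted tge (box n); rewrite (sorted_pairwise trge) => s1.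
have s2 : uniq (sort ge (box n)) by rewrite sort_uniq box_uniq.
have : pairwise [rel x y | ge x y && (x != y)] (sort ge (box n)).
  by rewrite pairwise_relI s1 -uniq_pairwise.
by apply: sub_pairwise => x y /= /andP[/orP[/eqP->|//]]; rewrite eqxx.
Qed.

End Lex.

(** The ratio of the volumes of boxes of sides [n.+1 + m] and [n.+1]: boundary layers are
    negligible. *)
Lemma cvg_box_ratio (R : realType) (m d : nat) :
  (fun n => (1 + m%:R / n.+1%:R) ^+ d : R) @ \oo --> (1 : R).
Proof.
have h : (fun n => 1 + m%:R * harmonic n : R) @ \oo --> (1 + m%:R * 0 : R).
  by apply: cvgD; [exact: cvg_cst|apply: cvgMr; exact: cvg_harmonic].
rewrite mulr0 addr0 in h.
by have := cvg_comp _ _ h (@exprn_continuous R d 1); rewrite expr1n.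
Qed.

(** * Comparison on large boxes and the conditional bound *)

Section Szego.
Variables (R : realType) (d : nat) (f : d.-tuple R -> R).
Hypotheses (mf : measurable_fun setT f) (f01 : forall x, 0 <= f x <= 1).
Variable p : seq 'rV[int]_d -> bitseq -> R.
Hypothesis pE : forall s t, uniq s -> size t = size s -> (p s t)%:C%C = pattern_det f s t.
Hypothesis p0 : forall s t, 0 <= p s t.
Implicit Types (s : seq 'rV[int]_d) (t : bitseq) (v : 'rV[int]_d).

Let descending := pairwise (fun x y : 'rV[int]_d => lexlt y x).

Lemma descending_uniq s : descending s -> uniq s.
Proof.
rewrite uniq_pairwise; apply: sub_pairwise => x y xy; apply/eqP => E.
by rewrite E lexlt_irr in xy.
Qed.

(* Every interior point [x] of the box contributes a factor at most [r]: the past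
   of [x] inside the box contains the translate of [s]. *)
Lemma ones_interior_le v s c (r : R) n : descending (v :: s) -> c v = 1 ->
  quad f (v :: s) c = r%:C%C -> 0 <= r ->
  forall L, descending L -> {subset L <= box d n} ->
    (forall x y, x \in L -> y \in box d n -> lexlt y x -> y \in L) ->
    p L (nseq (size L) true) <=
      r ^+ count (fun x => all (fun y => x - v + y \in box d n) (v :: s)) L.
Proof.
move=> dvs cv qr r0; have uvs := descending_uniq dvs.
have /andP[/allP vmax ds] : all (fun y => lexlt y v) s && descending s by [].
elim=> [|x L IH] dL sL cL.
  rewrite expr0 -lecR pE //= /pattern_det det_mx00 // lexx //.
have uL := descending_uniq dL; have /andP[xL _] := uL.
have /andP[/allP xmax dL'] : all (fun y => lexlt y x) L && descending L by [].
(* The tail is again closed under predecessors: a predecessor of one of its sites cannot be [x], the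
   largest. *)
have {}IH : p L (nseq (size L) true) <=
    r ^+ count (fun x => all (fun y => x - v + y \in box d n) (v :: s)) L.
  apply: IH => // [y yL|y z yL zb zy]; first by apply: sL; rewrite inE yL orbT.
  have : z \in x :: L by apply: cL zb zy; rewrite inE yL orbT.
  rewrite inE => /predU1P[E|//]; have := lexlt_trans zy (xmax _ yL).
  by rewrite E lexlt_irr.
pose int x := all (fun y => x - v + y \in box d n) (v :: s).
rewrite -[count _ (x :: L)]/(int x + count int L)%N.
(* A boundary site contributes a factor at most 1. *)
have [xint|_] := boolP (int x); last first.
  rewrite add0n; apply: le_trans _ IH.
  rewrite -(prob_cons pE uL) ?size_nseq //= lerDl; exact: p0.
rewrite add1n exprS.
have uws : uniq (map (+%R (x - v)) (v :: s)) by rewrite map_inj_uniq //; exact: addrI.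
(* The test function [c] moved by the translation taking [v] to [x], and extended by 0 to the rest
   of the past. *)
pose c' z := if z \in map (+%R (x - v)) (v :: s) then c (v - x + z) else 0.
have wK z : v - x + (x - v + z) = z by rewrite addrA -(opprB x v) addNr add0r.
have c'x : c' x = 1.
  have xm : x \in map (+%R (x - v)) (v :: s) by rewrite /= subrK mem_head.
  by rewrite /c' xm subrK.
have sub : {subset map (+%R (x - v)) (v :: s) <= x :: L}.
  move=> z /mapP[y yvs ->]; move: (allP xint _ yvs) => yb.
  move: yvs; rewrite inE => /predU1P[->|ys]; first by rewrite subrK mem_head.
  apply: cL yb _; first exact: mem_head.
  by rewrite -[X in lexlt _ X](subrK v) lexltD; exact: vmax.
have qx : quad f (x :: L) c' = r%:C%C.
  rewrite (quad_sub f uL uws sub) => [|z zn]; last by rewrite /c' (negPf zn).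
  rewrite quad_translate -qr; apply: eq_quad => z zvs.
  by rewrite /c' mem_map ?zvs ?wK //; exact: addrI.
have := prob_ones_le mf f01 pE p0 uL c'x; rewrite qx -rmorphM /= lecR => /le_trans; apply.
by rewrite mulrC ler_wpM2l.
Qed.

Lemma szego_le v s c (r : R) : descending (v :: s) -> c v = 1 ->
  quad f (v :: s) c = r%:C%C -> 0 < GM f -> GM f <= r.
Proof.
move=> dvs cv qr gf; have uvs := descending_uniq dvs.
have r0 : 0 <= r by have [r' q' r'0] := quad_real mf f01 (v :: s) c; move: q'; rewrite qr => -[->].
(* From here on [r < 1], so a lower bound on the number of interior sites bounds the power of [r]
   from above. *)
have [r1|r1] := leP 1 r; first exact: le_trans (GM_le1 f01 gf) r1.
(* The reach of the pattern around [v] in the sup norm: sites at distance at least [m] from the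
   boundary are interior. *)
pose m := (\max_(y <- v :: s) \max_(i < d) absz ((y - v)%R ord0 i))%N.
have mP y i : y \in v :: s -> (absz ((y - v)%R ord0 i) <= m)%N.
  move=> ys; apply: (@leq_trans (\max_(i < d) absz ((y - v)%R ord0 i))).
    exact: (@leq_bigmax _ (fun i => absz ((y - v)%R ord0 i)) i).
  exact: (@leq_bigmax_seq _ (v :: s) xpredT
    (fun y : 'rV[int]_d => \max_(i < d) absz ((y - v)%R ord0 i))%N y ys isT).
clearbody m.
(* Both sides bracket the probability of ones on the box of side [n.+1 + 2m], whose interior sites
   include the box of side [n.+1] shifted by [m] in every coordinate. *)
have main n : GM f ^+ ((n.+1 + m.*2) ^ d) <= r ^+ (n.+1 ^ d).
  have [L pL dL] := box_descending d (n.+1 + m.*2).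
  have uL := descending_uniq dL.
  have mL := perm_mem pL.
  have sL : size L = ((n.+1 + m.*2) ^ d)%N by rewrite (perm_size pL) size_box.
  rewrite -sL; apply: le_trans (prob_ones_ge mf f01 pE uL gf) _.
  apply: le_trans (ones_interior_le dvs cv qr r0 dL _ _) _.
  - by move=> x; rewrite mL; exact: id.
  - by move=> x y _ yb _; rewrite mL.
  apply: ler_wiXn2l => //; first exact: ltW.
  rewrite -(size_box d) -size_filter -(size_map (+%R (\row_i (m : int)))).
  apply: uniq_leq_size.
    by rewrite map_inj_uniq ?box_uniq //; exact: addrI.
  move=> x /mapP[z zb ->].
  have int y : y \in v :: s -> \row_i (m : int) + z - v + y \in box d (n.+1 + m.*2).
    move=> ys; rewrite mem_box; apply/forallP => i.
    move: zb; rewrite mem_box => /forallP/(_ i).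
    have := mP y i ys; rewrite !mxE; move: (y _ _) (v _ _) (z _ _) => a b e.
    rewrite -addnn; clear; lia.
  rewrite mem_filter; apply/andP; split; first by apply/allP => y /int.
  by rewrite mL; have := int v (mem_head _ _); rewrite subrK.
have rgt0 : 0 < r.
  have := main 0; rewrite exp1n expr1; apply: lt_le_trans; exact: exprn_gt0.
suff : ln (GM f) <= ln r by rewrite ler_ln ?posrE.
(* Take logarithms in [main], divide by the volume [n.+1 ^ d] and let [n] grow. *)
rewrite -[leLHS]mulr1.
apply: (@ler_cvg_to _ \oo _ _ (fun n => ln (GM f) * (1 + m.*2%:R / n.+1%:R) ^+ d) (fun=> ln r)).
- by apply: cvgMr; exact: cvg_box_ratio.
- exact: cvg_cst.
near=> n.
have n0 : (0 : R) < n.+1%:R by rewrite ltr0n.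
have := main n; rewrite -ler_ln ?posrE ?exprn_gt0 // !lnXn //.
rewrite -[ln r *+ _]mulr_natl -[ln (GM f) *+ _]mulr_natl !natrX => H.
rewrite -(ler_pM2l (exprn_gt0 d n0)); apply: le_trans _ H.
rewrite mulrCA -exprMn mulrDr mulr1 mulrCA mulfV ?gt_eqF // mulr1 -natrD mulrC.
by [].
Unshelve. all: by end_near.
Qed.

(** The conditional bound with its denominator cleared, so that it also makes sense for patterns of
    probability 0. *)
Lemma conditional_ge v s t : descending (v :: s) -> size t = size s ->
  GM f * p s t <= p (v :: s) (true :: t).
Proof.
move=> dvs st; have uvs := descending_uniq dvs.
have [gf|gf] := ltP 0 (GM f); last by apply: le_trans (p0 _ _); exact: mulr_le0_ge0.
have := p0 s t; rewrite le_eqVlt => /predU1P[<-|pst]; first by rewrite mulr0.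
have [c cv] := prob_true_ge mf f01 pE uvs st pst.
have [r qr r0] := quad_real mf f01 (v :: s) c.
rewrite qr -rmorphM /= lecR; apply: le_trans; rewrite mulrC ler_pM2l //.
exact: szego_le dvs cv qr gf.
Qed.

End Szego.

(** * Probabilities of cylinders *)

Section Cylinder.
Variable d : nat.

Lemma measurable_coord (x : 'rV[int]_d) (b : bool) :
  measurable [set eta : config d | eta x = b].
Proof.
apply: sub_sigma_algebra.
apply: (@open_comp _ _ (proj x : {ptws 'rV[int]_d -> bool} -> bool) [set b]).
  by move=> + _; exact: proj_continuous.
exact: discrete_open.
Qed.

Definition mask_event n (e : 'I_n -> 'rV[int]_d) (m : 'I_n -> option bool) :
    set (config d) :=
  [set eta | forall i, if m i is Some b then eta (e i) = b else True].

Lemma measurable_mask_event n (e : 'I_n -> 'rV[int]_d) m :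
  measurable (mask_event e m).
Proof.
rewrite (_ : mask_event e m = \bigcap_(i in setT)
    (if m i is Some b then [set eta : config d | eta (e i) = b] else setT)).
  apply: fin_bigcap_measurable; first exact: finite_finset.
  by move=> i _; case: (m i) => // b; exact: measurable_coord.
apply/seteqP; split => eta /=.
  by move=> H i _ /=; have := H i; case: (m i).
by move=> H i; have := H i I => /=; case: (m i).
Qed.

End Cylinder.

(** * Inclusion-exclusion for determinantal probabilities *)

Section MaskDet.
Variables (R : realType) (d : nat) (f : d.-tuple R -> R) (P : probability (config d) R).
Hypothesis detP : determinantal f P.

(* An unconstrained site gets the corresponding row of the identity matrix. *)
Definition mask_mx n (Q : 'M[R[i]]_n) (m : 'I_n -> option bool) : 'M[R[i]]_n :=
  \matrix_(i, j) match m i with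
                 | Some true => Q i j
                 | Some false => (i == j)%:R - Q i j
                 | None => (i == j)%:R
                 end.

(** Induction on the number of sites, then on the number of zeros. An unconstrained site is deleted
    by expanding along its unit row; a zero is written as unconstrained minus one, the determinant
    being linear in that row; with ones only, the defining property applies. *)
Lemma mask_event_det n (e : 'I_n -> 'rV[int]_d) m : injective e ->
  (fine (P (mask_event e m)))%:C%C = \det (mask_mx (gram f e) m).
Proof.
elim: n e m => [|n IHn] e m ie.
  rewrite det_mx00 (_ : mask_event e m = setT) ?probability_setT //.
  by apply/seteqP; split => // eta _ [].
have [k] := ubnP #|[pred i | m i == Some false]|.
elim: k m => // k IHk m; rewrite ltnS => mk.
have [i /eqP mi|noN] := pickP [pred i | m i == None].
  have -> : \det (mask_mx (gram f e) m) =
      \det (mask_mx (gram f (fun j => e (lift i j))) (fun j => m (lift i j))).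
    rewrite (expand_det_row _ i) (bigD1 i) //= big1 ?addr0 => [|j ji]; last first.
      by rewrite mxE mi eq_sym (negPf ji) mul0r.
    rewrite mxE mi eqxx mul1r /cofactor -signr_odd oddD addbb mul1r.
    congr (\det _); apply/matrixP => a b; rewrite !mxE (inj_eq lift_inj).
    by [].
  rewrite -IHn; last by move=> a b /ie /lift_inj.
  congr ((fine (P _))%:C%C); apply/seteqP; split => eta H j; first exact: H.
  by case: (unliftP i j) => [a ->|->]; [exact: H|rewrite mi].
have [i /eqP mi|noF] := pickP [pred i | m i == Some false]; last first.
  have mT j : m j = Some true.
    by have := noN j; have := noF j; rewrite /=; case: (m j) => [[]|].
  rewrite (_ : mask_mx _ _ = \matrix_(a < n.+1, b < n.+1) fourier f (e b - e a)).
    rewrite -(detP (ltn0Sn n) ie); congr ((fine (P _))%:C%C).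
    by apply/seteqP; split => eta H j; have := H j; rewrite mT.
  by apply/matrixP => a b; rewrite !mxE mT.
pose m' o j := if j == i then o else m j.
have m'n o j : j != i -> m' o j = m j by rewrite /m' => /negPf ->.
have m'k o : o != Some false -> (#|[pred j | m' o j == Some false]| < k)%N.
  move=> oF; apply: leq_trans mk; apply/fintype.proper_card/fintype.properP; split.
    apply/fintype.subsetP => j; rewrite !inE /m'; have [_|//] := eqVneq j i.
    by rewrite (negPf oF).
  by exists i; rewrite !inE ?mi // /m' eqxx.
have D : \det (mask_mx (gram f e) m) =
    \det (mask_mx (gram f e) (m' None)) - \det (mask_mx (gram f e) (m' (Some true))).
  rewrite (@determinant_multilinear _ _ _ (mask_mx (gram f e) (m' None))
     (mask_mx (gram f e) (m' (Some true))) i 1 (-1)) ?mul1r ?mulN1r //.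
  - by apply/rowP => j; rewrite !mxE mi /m' eqxx mul1r mulN1r.
  - by apply/matrixP => a b; rewrite !mxE m'n // eq_sym neq_lift.
  - by apply/matrixP => a b; rewrite !mxE m'n // eq_sym neq_lift.
rewrite D -!IHk ?m'k // -rmorphB /=; congr (_%:C%C).
(* On the side of events, leaving site [i] free splits disjointly according to its value. *)
have -> : mask_event e (m' None) = mask_event e (m' (Some true)) `|` mask_event e m.
  apply/seteqP; split => eta.
    move=> H; case E : (eta (e i)); [left|right] => j.
      have := H j; rewrite /m'; case: eqP => [->|//]; by rewrite E.
    by have := H j; rewrite /m'; case: eqP => [->|//]; rewrite mi E.
  by move=> [] H j; have := H j; rewrite /m'; case: eqP.
rewrite measureU; first 1 last.
- exact: measurable_mask_event.
- exact: measurable_mask_event.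
- apply/seteqP; split => // eta [/(_ i) + /(_ i)].
  by rewrite /m' eqxx mi => ->.
by rewrite fineD ?fin_num_measure //; [rewrite addrAC subrr add0r|exact: measurable_mask_event..].
Qed.

Definition cylinder (s : seq 'rV[int]_d) (t : bitseq) : set (config d) :=
  [set eta : config d | [seq eta x | x <- s] = t].

Lemma cylinder_mask s t : size t = size s ->
  cylinder s t = mask_event (fun i : 'I_(size s) => nth 0 s i) (fun i => Some (nth false t i)).
Proof.
move=> st; apply/seteqP; split => eta; rewrite /cylinder /mask_event /=.
  by move=> <- i; rewrite (nth_map 0).
move=> H; apply: (@eq_from_nth _ false); first by rewrite size_map st.
by move=> i; rewrite size_map => si; rewrite (nth_map 0) // -(H (Ordinal si)).
Qed.

Lemma measurable_cylinder s t : measurable (cylinder s t).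
Proof.
have [st|st] := eqVneq (size t) (size s).
  by rewrite cylinder_mask //; exact: measurable_mask_event.
rewrite (_ : cylinder s t = set0) //; apply/seteqP; split => // eta E.
by move/eqP: st; rewrite -E size_map.
Qed.

Definition pattern_prob s t : R := fine (P (cylinder s t)).

Lemma pattern_probE s t : uniq s -> size t = size s ->
  (pattern_prob s t)%:C%C = pattern_det f s t.
Proof.
move=> us st; rewrite /pattern_prob cylinder_mask // mask_event_det; last exact: nth_inj_uniq.
by congr (\det _); apply/matrixP => i j; rewrite !mxE; case: nth.
Qed.

Lemma pattern_prob_ge0 s t : 0 <= pattern_prob s t.
Proof. exact: fine_ge0. Qed.

Lemma pattern_prob_translate s t w : uniq s -> size t = size s ->
  pattern_prob (map (+%R w) s) t = pattern_prob s t.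
Proof.
move=> us st; apply: complexI; rewrite !pattern_probE ?size_map //.
  exact: pattern_det_translate.
by rewrite map_inj_uniq //; exact: addrI.
Qed.

End MaskDet.

(** * Entropy *)

Section BinaryEntropy.
Variable R : realType.
Implicit Types p c lo hi : R.

Lemma entropy2_sym p : entropy2 (1 - p) = entropy2 p.
Proof. by rewrite /entropy2 subKr; ring. Qed.

(** A concave function on an interval is at least its smaller endpoint value; by symmetry the value
    at [1 - lo'] is that at [lo']. *)
Lemma entropy2_ge_min lo lo' c : 0 <= lo -> 0 <= lo' -> lo <= c -> c <= 1 - lo' ->
  Num.min (entropy2 lo) (entropy2 lo') <= entropy2 c.
Proof.
move=> l0 l0' lc cl; rewrite -(entropy2_sym lo'); set hi := 1 - lo'.
have h1 : hi <= 1 by rewrite gerBl.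
(* Endpoints are set aside so that [c] and [1 - c] are positive, as the tangent inequalities
   require. *)
have [<-|clo] := eqVneq lo c; first by rewrite ge_min lexx.
have [->|chi] := eqVneq c hi; first by rewrite ge_min lexx orbT.
have loc : lo < c by rewrite lt_neqAle clo.
have chi' : c < hi by rewrite lt_neqAle chi.
pose th := (hi - c) / (hi - lo).
have hl : 0 < hi - lo by lra.
have th0 : 0 <= th by rewrite divr_ge0 //; lra.
have th1 : 0 <= 1 - th.
  by rewrite subr_ge0 ler_pdivrMr //; lra.
have cE : c = th * lo + (1 - th) * hi by rewrite /th; field; rewrite gt_eqF.
have c0 : 0 < c by lra.
have c1 : 0 < 1 - c by lra.
(* Each endpoint entropy is at most its cross entropy relative to [c], which is affine in the
   endpoint and equals [entropy2 c] at [c]. *)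
have t1 := xlnx_tangent l0 c0.
have t2 : hi * ln c + hi - c <= hi * ln hi by apply: xlnx_tangent => //; lra.
have t3 : (1 - lo) * ln (1 - c) + (1 - lo) - (1 - c) <= (1 - lo) * ln (1 - lo).
  by apply: xlnx_tangent => //; lra.
have t4 : (1 - hi) * ln (1 - c) + (1 - hi) - (1 - c) <= (1 - hi) * ln (1 - hi).
  by apply: xlnx_tangent => //; lra.
have e1 : entropy2 lo <= - lo * ln c - (1 - lo) * ln (1 - c).
  by rewrite /entropy2; lra.
have e2 : entropy2 hi <= - hi * ln c - (1 - hi) * ln (1 - c).
  by rewrite /entropy2; lra.
have : th * entropy2 lo + (1 - th) * entropy2 hi <= entropy2 c.
  have -> : entropy2 c = th * (- lo * ln c - (1 - lo) * ln (1 - c)) +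
      (1 - th) * (- hi * ln c - (1 - hi) * ln (1 - c)).
    by rewrite /entropy2 {1 3}cE; ring.
  by apply: lerD; apply: ler_wpM2l.
apply: le_trans.
have m1 : Num.min (entropy2 lo) (entropy2 hi) <= entropy2 lo by rewrite ge_min lexx.
have m2 : Num.min (entropy2 lo) (entropy2 hi) <= entropy2 hi by rewrite ge_min lexx orbT.
have := lerD (ler_wpM2l th0 m1) (ler_wpM2l th1 m2).
by rewrite -mulrDl addrC subrK mul1r.
Qed.

End BinaryEntropy.

Lemma sum_fst_eq (V : nmodType) (A B : finType) (F : A * B -> V) a :
  \sum_(ab | ab.1 == a) F ab = \sum_b F (a, b).
Proof.
transitivity (\sum_(a' | a' == a) \sum_b F (a', b)); last by rewrite big_pred1_eq.
rewrite pair_big /=.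
by apply: eq_big => [[a' b']|[a' b']] //=; rewrite andbT.
Qed.

Lemma sum_snd_eq (V : nmodType) (A B : finType) (F : A * B -> V) b :
  \sum_(ab | ab.2 == b) F ab = \sum_a F (a, b).
Proof.
transitivity (\sum_a \sum_(b' | b' == b) F (a, b')); last first.
  by apply: eq_bigr => a _; rewrite big_pred1_eq.
by rewrite pair_big_dep /=; apply: eq_big => [[a' b']|[a' b']].
Qed.

(** * Shannon entropy of finite partitions *)

Section PartitionEntropy.
Context d (T : measurableType d) (R : realType) (mu : probability T R).

Definition measurable_label (A : finType) (xi : T -> A) :=
  forall a, measurable (xi @^-1` [set a]).

Definition label_prob (A : finType) (xi : T -> A) (a : A) : R :=
  fine (mu (xi @^-1` [set a])).

Lemma partition_entropyE (A : finType) (xi : T -> A) :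
  partition_entropy mu xi = - \sum_a label_prob xi a * ln (label_prob xi a).
Proof. by []. Qed.

Lemma label_prob_ge0 (A : finType) (xi : T -> A) a : 0 <= label_prob xi a.
Proof. exact: fine_ge0. Qed.

Lemma label_mem (A : finType) (xi : T -> A) (r : seq A) : measurable_label xi -> uniq r ->
  measurable [set x | xi x \in r] /\
  fine (mu [set x | xi x \in r]) = \sum_(a <- r) label_prob xi a.
Proof.
move=> mxi; elim: r => [|a r IH] /=.
  move=> _; rewrite big_nil (_ : [set x | xi x \in [::]] = set0); last by apply/seteqP; split.
  by rewrite measure0.
move=> /andP[ar /IH[mr IHr]].
have -> : [set x | xi x \in a :: r] = xi @^-1` [set a] `|` [set x | xi x \in r].
  apply/seteqP; split => x /=; rewrite inE.
    by move=> /predU1P[]; [left|right].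
  by move=> [->|->]; rewrite ?eqxx ?orbT.
split; first exact: measurableU.
rewrite big_cons -IHr measureU ?fineD ?fin_num_measure //.
by apply/seteqP; split => // x [/= -> H]; rewrite H in ar.
Qed.

Lemma label_preimage (A : finType) (xi : T -> A) (Q : pred A) : measurable_label xi ->
  measurable [set x | Q (xi x)] /\
  fine (mu [set x | Q (xi x)]) = \sum_(a | Q a) label_prob xi a.
Proof.
move=> mxi; have [m1 m2] := label_mem mxi (filter_uniq Q (enum_uniq A)).
rewrite (_ : [set x | Q (xi x)] = [set x | xi x \in [seq a <- enum A | Q a]]).
  by split=> //; rewrite m2 big_filter big_enum_cond.
by apply/seteqP; split => x /=; rewrite mem_filter mem_enum andbT.
Qed.

Lemma label_comp_set (A B : finType) (xi : T -> A) (g : A -> B) b :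
  (g \o xi) @^-1` [set b] = [set x | g (xi x) == b].
Proof. by apply/seteqP; split => x /= /eqP. Qed.

Lemma measurable_label_comp (A B : finType) (xi : T -> A) (g : A -> B) :
  measurable_label xi -> measurable_label (g \o xi).
Proof.
by move=> mxi b; rewrite label_comp_set; have [] := label_preimage (fun a => g a == b) mxi.
Qed.

Lemma label_prob_comp (A B : finType) (xi : T -> A) (g : A -> B) b : measurable_label xi ->
  label_prob (g \o xi) b = \sum_(a | g a == b) label_prob xi a.
Proof.
move=> mxi; rewrite /label_prob label_comp_set.
by have [_] := label_preimage (fun a => g a == b) mxi.
Qed.

Lemma sum_label_prob (A : finType) (xi : T -> A) : measurable_label xi ->
  \sum_a label_prob xi a = 1.
Proof.
move=> mxi; have [_] := label_preimage xpredT mxi => <-.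
by rewrite (_ : [set x | _] = setT) ?probability_setT //; apply/seteqP; split.
Qed.

Lemma label_prob_le1 (A : finType) (xi : T -> A) a : measurable_label xi -> label_prob xi a <= 1.
Proof.
move=> mxi; rewrite -(sum_label_prob mxi) (bigD1 a) //= lerDl.
by apply: sumr_ge0 => *; exact: label_prob_ge0.
Qed.

Lemma partition_entropy_ge0 (A : finType) (xi : T -> A) : measurable_label xi ->
  0 <= partition_entropy mu xi.
Proof.
move=> mxi; rewrite partition_entropyE oppr_ge0; apply: sumr_le0 => a _.
by apply: mulr_ge0_le0; [exact: label_prob_ge0|apply: ln_le0; exact: label_prob_le1].
Qed.

(** Coarsening only enlarges the atom containing a point, hence the logarithm of its probability. *)
Lemma partition_entropy_comp (A B : finType) (xi : T -> A) (g : A -> B) :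
  measurable_label xi -> partition_entropy mu (g \o xi) <= partition_entropy mu xi.
Proof.
move=> mxi; rewrite !partition_entropyE lerN2.
rewrite (partition_big g xpredT) //=; apply: ler_sum => b _.
rewrite {1}label_prob_comp // mulr_suml; apply: ler_sum => a /eqP ab.
have := label_prob_ge0 xi a; rewrite le_eqVlt => /predU1P[<-|pa]; first by rewrite !mul0r.
rewrite ler_pM2l // ler_ln ?posrE //; last first.
  apply: lt_le_trans pa _; rewrite label_prob_comp // (bigD1 a) ?ab //= lerDl.
  by apply: sumr_ge0 => *; exact: label_prob_ge0.
rewrite label_prob_comp // (bigD1 a) ?ab //= lerDl.
by apply: sumr_ge0 => *; exact: label_prob_ge0.
Qed.

Lemma measurable_label_pair (A B : finType) (xi : T -> A) (zeta : T -> B) :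
  measurable_label xi -> measurable_label zeta -> measurable_label (fun x => (xi x, zeta x)).
Proof.
move=> mxi mz [a b]; rewrite (_ : _ @^-1` _ = xi @^-1` [set a] `&` zeta @^-1` [set b]).
  exact: measurableI.
by apply/seteqP; split => x /= [-> ->].
Qed.

(** Gibbs' inequality between the joint law and the product of its marginals. *)
Lemma partition_entropy_pair (A B : finType) (xi : T -> A) (zeta : T -> B) :
  measurable_label xi -> measurable_label zeta ->
  partition_entropy mu (fun x => (xi x, zeta x)) <=
  partition_entropy mu xi + partition_entropy mu zeta.
Proof.
move=> mxi mz; have mp := measurable_label_pair mxi mz.
set pi := label_prob (fun x => (xi x, zeta x)).
have pi0 ab : 0 <= pi ab by exact: label_prob_ge0.
have p1 a : label_prob xi a = \sum_b pi (a, b).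
  rewrite -[xi]/(fst \o (fun x => (xi x, zeta x))) label_prob_comp //.
  exact: sum_fst_eq.
have p2 b : label_prob zeta b = \sum_a pi (a, b).
  rewrite -[zeta]/(snd \o (fun x => (xi x, zeta x))) label_prob_comp //.
  exact: sum_snd_eq.
rewrite !partition_entropyE -opprD lerN2.
have -> : \sum_a label_prob xi a * ln (label_prob xi a) +
    \sum_b label_prob zeta b * ln (label_prob zeta b) =
    \sum_a \sum_b pi (a, b) * (ln (label_prob xi a) + ln (label_prob zeta b)).
  under [RHS]eq_bigr => a _ do under eq_bigr => b _ do rewrite mulrDr.
  under [RHS]eq_bigr => a _ do rewrite big_split /=.
  rewrite big_split /=; congr (_ + _).
    by apply: eq_bigr => a _; rewrite {1}p1 mulr_suml.
  by rewrite exchange_big /=; apply: eq_bigr => b _; rewrite {1}p2 mulr_suml.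
have -> : \sum_ab label_prob (fun x => (xi x, zeta x)) ab *
    ln (label_prob (fun x => (xi x, zeta x)) ab) =
   \sum_a \sum_b pi (a, b) * ln (pi (a, b)).
  by rewrite pair_big /=; apply: eq_bigr => -[].
rewrite -subr_ge0 -sumrB.
(* The linear terms of the tangent inequalities cancel, both laws having mass 1. *)
have Z : \sum_a \sum_b (pi (a, b) - label_prob xi a * label_prob zeta b) = 0.
  under eq_bigr => a _ do rewrite sumrB -p1 -mulr_sumr sum_label_prob // mulr1 subrr.
  by rewrite big1.
rewrite -[leLHS]Z.
apply: ler_sum => a _; rewrite -sumrB; apply: ler_sum => b _.
have := label_prob_ge0 (fun x => (xi x, zeta x)) (a, b); rewrite -/pi le_eqVlt => /predU1P[<-|pab].
  by rewrite !mul0r subr0 sub0r oppr_le0; apply: mulr_ge0; exact: label_prob_ge0.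
have pa : 0 < label_prob xi a.
  by apply: lt_le_trans pab _; rewrite p1 (bigD1 b) //= lerDl sumr_ge0.
have pb : 0 < label_prob zeta b.
  by apply: lt_le_trans pab _; rewrite p2 (bigD1 a) //= lerDl sumr_ge0.
have := xlnx_tangent (ltW pab) (mulr_gt0 pa pb); rewrite lnM ?posrE //.
by set X := label_prob xi a * _; lra.
Qed.

(** The chain rule: the bit adds the mean over [a] of [entropy2] of its conditional probability,
    which lies between [lo] and [1 - lo']. *)
Lemma partition_entropy_bit (A : finType) (xi : T -> A) (bit : T -> bool) (lo lo' : R) :
  measurable_label xi -> measurable_label bit -> 0 <= lo -> 0 <= lo' ->
  (forall a, lo * label_prob xi a <= label_prob (fun x => (bit x, xi x)) (true, a)) ->
  (forall a, lo' * label_prob xi a <= label_prob (fun x => (bit x, xi x)) (false, a)) ->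
  partition_entropy mu xi + Num.min (entropy2 lo) (entropy2 lo') <=
  partition_entropy mu (fun x => (bit x, xi x)).
Proof.
move=> mxi mb l0 l0' hlo hlo'; have mp := measurable_label_pair mb mxi.
move: hlo hlo'; set pi := label_prob (fun x => (bit x, xi x)) => hlo hlo'.
have pi0 ab : 0 <= pi ab by exact: label_prob_ge0.
have pE a : label_prob xi a = pi (true, a) + pi (false, a).
  rewrite -[xi]/(snd \o (fun x => (bit x, xi x))) label_prob_comp //.
  by rewrite sum_snd_eq big_bool.
set m := Num.min _ _.
have key a : - (label_prob xi a * ln (label_prob xi a)) + label_prob xi a * m <=
    - (pi (true, a) * ln (pi (true, a)) + pi (false, a) * ln (pi (false, a))).
  have := label_prob_ge0 xi a; rewrite le_eqVlt => /predU1P[E|pa].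
    have := pi0 (true, a); have := pi0 (false, a); have := pE a; rewrite -E => E' h1 h2.
    have -> : pi (true, a) = 0 by lra.
    have -> : pi (false, a) = 0 by lra.
    by rewrite !mul0r addr0 oppr0 addr0.
  (* The conditional probability of a one given the atom [a]. *)
  pose c := pi (true, a) / label_prob xi a.
  have c1E : pi (true, a) = label_prob xi a * c by rewrite /c; field; rewrite gt_eqF.
  have c0E : pi (false, a) = label_prob xi a * (1 - c).
    by rewrite mulrBr mulr1 -c1E pE addrAC subrr add0r.
  have lc : lo <= c by rewrite ler_pdivlMr.
  have cl : c <= 1 - lo'.
    have := hlo' a; rewrite c0E mulrC ler_pM2l //; lra.
  have mh : m <= entropy2 c := entropy2_ge_min l0 l0' lc cl.
  have xln (x y : R) : 0 < x -> 0 <= y -> x * y * ln (x * y) = y * (x * ln x) + x * (y * ln y).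
    move=> x0; rewrite le_eqVlt => /predU1P[<-|y0]; first by rewrite !(mul0r, mulr0) addr0.
    by rewrite lnM ?posrE //; ring.
  have cp : 0 <= c by exact: le_trans lc.
  have cm : 0 <= 1 - c by rewrite subr_ge0; apply: le_trans cl _; rewrite gerBl.
  clearbody c; rewrite c1E c0E !xln //.
  have := ler_wpM2l (ltW pa) mh; rewrite /entropy2.
  rewrite -(lerD2l (- (label_prob xi a * ln (label_prob xi a)))) => /le_trans; apply.
  by rewrite le_eqVlt; apply/orP; left; apply/eqP; ring.
rewrite !partition_entropyE.
have -> : \sum_ab label_prob (fun x => (bit x, xi x)) ab *
    ln (label_prob (fun x => (bit x, xi x)) ab) =
   \sum_a (pi (true, a) * ln (pi (true, a)) + pi (false, a) * ln (pi (false, a))).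
  transitivity (\sum_b \sum_a pi (b, a) * ln (pi (b, a))).
    by rewrite pair_big /=; apply: eq_bigr => -[].
  by rewrite big_bool /= -big_split.
rewrite -!sumrN -[X in _ + X]mul1r -(sum_label_prob mxi) mulr_suml -big_split /=.
by apply: ler_sum => a _; exact: key.
Qed.

End PartitionEntropy.

(** * Entropy of finite windows of a configuration *)

Section SeqEntropy.
Variables (R : realType) (d : nat) (P : probability (config d) R).
Implicit Types (s : seq 'rV[int]_d).

Definition restriction s (eta : config d) : (size s).-tuple bool :=
  map_tuple (fun x => eta x) (in_tuple s).

Lemma restriction_preimage s (t : (size s).-tuple bool) :
  restriction s @^-1` [set t] = cylinder s t.
Proof.
apply/seteqP; split => eta; first by move=> /= <-.
by move=> E; apply: val_inj; rewrite /= -E.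
Qed.

Lemma measurable_restriction s : measurable_label (restriction s).
Proof. by move=> t; rewrite restriction_preimage; exact: measurable_cylinder. Qed.

Lemma label_prob_restriction s t : label_prob P (restriction s) t = pattern_prob P s t.
Proof. by rewrite /label_prob restriction_preimage. Qed.

Definition seq_entropy s : R := partition_entropy P (restriction s).

Lemma seq_entropy_sub s s' : {subset s <= s'} -> seq_entropy s <= seq_entropy s'.
Proof.
move=> ss'.
pose g (t : (size s').-tuple bool) : (size s).-tuple bool :=
  map_tuple (fun x => nth false t (index x s')) (in_tuple s).
rewrite /seq_entropy (_ : restriction s = g \o restriction s').
  exact: partition_entropy_comp (@measurable_restriction s').
apply/funext => eta; apply: val_inj => /=; apply/eq_in_map => x /ss' xs'.
by rewrite (nth_map 0) ?index_mem // nth_index.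
Qed.

Lemma seq_entropy_cat s s' : seq_entropy (s ++ s') <= seq_entropy s + seq_entropy s'.
Proof.
pose g (t : (size s).-tuple bool * (size s').-tuple bool) : (size (s ++ s')).-tuple bool :=
  tcast (esym (size_cat s s')) (cat_tuple t.1 t.2).
have mp := measurable_label_pair (@measurable_restriction s) (@measurable_restriction s').
apply: le_trans (partition_entropy_pair P (@measurable_restriction s)
  (@measurable_restriction s')).
rewrite /seq_entropy (_ : restriction (s ++ s') =
    g \o (fun eta => (restriction s eta, restriction s' eta))).
  exact: partition_entropy_comp mp.
by apply/funext => eta; apply: val_inj; rewrite /= val_tcast /= map_cat.
Qed.

Lemma seq_entropy_nil : seq_entropy [::] = 0.
Proof.
rewrite /seq_entropy partition_entropyE.
rewrite (eq_bigr (fun t => label_prob P (restriction [::]) t * 0)) => [|t _].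
  by rewrite -mulr_suml mulr0 oppr0.
congr (_ * _); rewrite label_prob_restriction /pattern_prob (tuple0 t).
rewrite (_ : cylinder _ _ = setT); last by apply/seteqP; split.
by rewrite probability_setT /= ln1.
Qed.

Lemma seq_entropy_flatten (ss : seq (seq 'rV[int]_d)) :
  seq_entropy (flatten ss) <= \sum_(s <- ss) seq_entropy s.
Proof.
elim: ss => [|s ss IH]; first by rewrite big_nil seq_entropy_nil.
by rewrite big_cons /=; apply: le_trans (seq_entropy_cat _ _) _; rewrite lerD2l.
Qed.

(** The length is a variable so that a list and its translate are summed over the same type of
    tuples. *)
Lemma seq_entropyE n s : n = size s ->
  seq_entropy s = - \sum_(t : n.-tuple bool) pattern_prob P s t * ln (pattern_prob P s t).
Proof.
move=> e; subst n; rewrite /seq_entropy partition_entropyE; congr (- _).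
by apply: eq_bigr => t _; rewrite label_prob_restriction.
Qed.

Lemma seq_entropy_cons v s :
  partition_entropy P (fun eta : config d => (eta v, restriction s eta)) <= seq_entropy (v :: s).
Proof.
pose g (t : (size s).+1.-tuple bool) : bool * (size s).-tuple bool :=
  (thead t, [tuple of behead t]).
rewrite /seq_entropy (_ : (fun eta : config d => _) = g \o restriction (v :: s)).
  exact: partition_entropy_comp (@measurable_restriction (v :: s)).
apply/funext => eta; rewrite /g /=; congr (_, _).
by apply: val_inj.
Qed.

(** The partition by the symbol at the origin, with labels in an ordinal as in [ks_entropy]. *)
Definition bit0 (eta : config d) : 'I_2 := if eta 0 then 1 else 0.

(** The join of the translates and the restriction to the box determine each other, so each entropy
    bounds the other. *)
Lemma box_join_entropy n :
  partition_entropy P (box_join (@config_shift d) bit0 n) = seq_entropy (box d n).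
Proof.
pose pt (v : {ffun 'I_d -> 'I_n}) : 'rV[int]_d := \row_i (v i : nat)%:Z.
have ptb v : pt v \in box d n by apply: map_f; rewrite mem_enum.
have bj eta v : box_join (@config_shift d) bit0 n eta v = if eta (pt v) then 1 else 0.
  by rewrite ffunE /bit0 /config_shift add0r.
pose g (t : (size (box d n)).-tuple bool) : {ffun {ffun 'I_d -> 'I_n} -> 'I_2} :=
  [ffun v => if nth false t (index (pt v) (box d n)) then 1 else 0].
have gE : box_join (@config_shift d) bit0 n = g \o restriction (box d n).
  apply/funext => eta; apply/ffunP => v; rewrite bj ffunE /=.
  by rewrite (nth_map 0) ?index_mem // nth_index.
have mr := @measurable_restriction (box d n).
apply/eqP; rewrite eq_le; apply/andP; split.
  by rewrite gE; exact: partition_entropy_comp.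
pose h (u : {ffun {ffun 'I_d -> 'I_n} -> 'I_2}) : (size (box d n)).-tuple bool :=
  map_tuple (fun x => if [pick v | pt v == x] is Some v then u v == 1 else false)
    (in_tuple (box d n)).
rewrite /seq_entropy (_ : restriction (box d n) = h \o box_join (@config_shift d) bit0 n).
  by apply: partition_entropy_comp; rewrite gE; exact: (measurable_label_comp P).
apply/funext => eta; apply: val_inj => /=; apply/eq_in_map => x xb.
case: pickP => [v /eqP <-|no]; first by rewrite bj; case: (eta _).
by move: xb => /mapP[v _ xE]; have := no v; rewrite /pt -xE eqxx.
Qed.

End SeqEntropy.

(** * Existence of the entropy rate *)

Section Rate.
Variables (R : realType) (d : nat) (f : d.-tuple R -> R) (P : probability (config d) R).
Hypothesis detP : determinantal f P.

Lemma seq_entropy_translate s w : uniq s ->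
  seq_entropy P (map (+%R w) s) = seq_entropy P s.
Proof.
move=> us; rewrite (@seq_entropyE _ _ _ (size s) s) //.
rewrite (@seq_entropyE _ _ _ (size s)) ?size_map //; congr (- _).
by apply: eq_bigr => t _; rewrite (pattern_prob_translate detP) ?size_tuple.
Qed.

(** Division with remainder by [k] in each coordinate covers the box by [q ^ d] translates of the
    box of side [k]; subadditivity and stationarity conclude. *)
Lemma seq_entropy_box_le n k q : (0 < k)%N -> (n <= q * k)%N ->
  seq_entropy P (box d n) <= (q ^ d)%:R * seq_entropy P (box d k).
Proof.
move=> k0 nqk.
pose ss := [seq map (+%R (k%:Z *: u)) (box d k) | u <- box d q].
have sub : {subset box d n <= flatten ss}.
  move=> _ /mapP[v _ ->].
  pose u : 'rV[int]_d := \row_i (v i %/ k)%N%:Z.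
  pose r : 'rV[int]_d := \row_i (v i %% k)%N%:Z.
  apply/flattenP; exists (map (+%R (k%:Z *: u)) (box d k)).
    apply: map_f; rewrite mem_box; apply/forallP => i.
    by rewrite mxE ltz_nat ltn_divLR // (leq_trans (ltn_ord _) nqk).
  apply/mapP; exists r.
    by rewrite mem_box; apply/forallP => i; rewrite mxE ltz_nat ltn_mod.
  by apply/rowP => i; rewrite !mxE -PoszM -PoszD mulnC -divn_eq.
apply: le_trans (seq_entropy_sub P sub) _.
apply: le_trans (seq_entropy_flatten P ss) _.
rewrite big_map (eq_bigr (fun=> seq_entropy P (box d k))) => [|u _].
  by rewrite big_const_seq count_predT size_box iter_addr_0 mulr_natl.
by apply: seq_entropy_translate; exact: box_uniq.
Qed.

Lemma seq_entropy_ge0 s : 0 <= seq_entropy P s.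
Proof. exact: partition_entropy_ge0 (@measurable_restriction d s). Qed.

(* Fekete's argument: a box of side [n] is covered by at most
   [((n + k) / k) ^ d] boxes of side [k]. *)
Lemma box_rate_cvg (m : R) :
  (forall n, (n.+1 ^ d)%:R * m <= seq_entropy P (box d n.+1)) ->
  exists2 l : R, (fun n => seq_entropy P (box d n) / (n ^ d)%:R) @ \oo --> l & m <= l.
Proof.
move=> hm; pose r n := seq_entropy P (box d n.+1) / (n.+1 ^ d)%:R.
have nd0 n : 0 < (n.+1 ^ d)%:R :> R by rewrite ltr0n expn_gt0.
have mr n : m <= r n by rewrite ler_pdivlMr // mulrC.
have rle n k : r n <= r k * (1 + k.+1%:R / n.+1%:R) ^+ d.
  (* Enough boxes of side [k.+1] to cover, overshooting the side by at most [k.+1]. *)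
  pose q := (n.+1 %/ k.+1).+1.
  have nq : (n.+1 <= q * k.+1)%N by rewrite ltnW // -ltn_divLR.
  have qn : (q * k.+1 <= n.+1 + k.+1)%N.
    by rewrite mulSn addnC leq_add2r leq_trunc_div.
  rewrite /r ler_pdivrMr //; apply: le_trans (seq_entropy_box_le (ltn0Sn k) nq) _.
  have -> : seq_entropy P (box d k.+1) / (k.+1 ^ d)%:R *
      (1 + k.+1%:R / n.+1%:R) ^+ d * (n.+1 ^ d)%:R =
      ((n.+1 + k.+1) ^ d)%:R / (k.+1 ^ d)%:R * seq_entropy P (box d k.+1).
    have Yb : (1 + k.+1%:R / n.+1%:R) ^+ d * (n.+1 ^ d)%:R = ((n.+1 + k.+1) ^ d)%:R :> R.
      by rewrite !natrX -exprMn natrD mulrDl mul1r mulfVK ?pnatr_eq0.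
    by rewrite -[LHS]mulrA Yb; ring.
  apply: ler_wpM2r; first exact: seq_entropy_ge0.
  rewrite ler_pdivlMr // -natrM ler_nat -expnMn.
  by have [->|d0] := posnP d; [rewrite !expn0|rewrite leq_exp2r].
(* The limit is the infimum of the rates: a [k] with rate near it controls all large [n]. *)
pose l := inf (range r).
have hi : has_inf (range r).
  by split; [exists (r 0%N); exists 0%N|exists m => _ [n _ <-]].
exists l; last by apply: lb_le_inf; [exists (r 0%N); exists 0%N|move=> _ [n _ <-]].
rewrite -(cvg_shiftS _ _); apply/cvgrPdist_lt => e e0.
have [_ [k _ <-] rk] := inf_adherent e0 hi.
have c : (fun n => r k * (1 + k.+1%:R / n.+1%:R) ^+ d) @ \oo --> r k.
  by rewrite -[X in _ --> X]mulr1; apply: cvgMr; exact: cvg_box_ratio.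
have : \forall n \near \oo, r k * (1 + k.+1%:R / n.+1%:R) ^+ d < l + e.
  by apply: (cvgr_lt _ c).
apply: filterS => n H; rewrite distrC ger0_norm ?subr_ge0; last first.
  by apply: ge_inf; [case: hi|exists n].
by rewrite ltrBlDl; apply: le_lt_trans (rle n k) H.
Qed.

End Rate.

(** * The entropy bound for descending windows *)

Section Bound.
Variables (R : realType) (d : nat) (f : d.-tuple R -> R) (P : probability (config d) R).
Hypotheses (mf : measurable_fun setT f) (f01 : forall x, 0 <= f x <= 1).
Hypothesis detP : determinantal f P.

(** Replacing [Q] by [1 - Q] exchanges the rows for ones and for zeros. *)
Lemma pattern_det_1B s t : uniq s -> size t = size s ->
  pattern_det (fun x => 1 - f x) s t = pattern_det f s (map negb t).
Proof.
move=> us st; rewrite /pattern_det.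
have -> : seq_gram (fun x => 1 - f x) s = 1%:M - seq_gram f s.
  by apply: gram_1B => //; exact: nth_inj_uniq.
congr (\det _); apply/matrixP => i j; rewrite !mxE (nth_map false) ?st //.
by case: nth => //=; rewrite opprB addrC subrK.
Qed.

Lemma GM_ge0 (g : d.-tuple R -> R) : 0 <= GM g.
Proof. by rewrite fine_ge0 // expeR_ge0. Qed.

Lemma pattern_prob_true v s t : pairwise (fun x y => lexlt y x) (v :: s) ->
  size t = size s -> GM f * pattern_prob P s t <= pattern_prob P (v :: s) (true :: t).
Proof.
exact: (conditional_ge mf f01 (pattern_probE detP) (pattern_prob_ge0 P)).
Qed.

(* Exchanging 0 and 1 turns the determinantal process of [f] into that of [1 - f]. *)
Lemma pattern_prob_false v s t : pairwise (fun x y => lexlt y x) (v :: s) ->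
  size t = size s ->
  GM (fun x => 1 - f x) * pattern_prob P s t <= pattern_prob P (v :: s) (false :: t).
Proof.
move=> dvs st; pose p' s t := pattern_prob P s (map negb t).
have m1f : measurable_fun setT (fun x => 1 - f x) by exact: measurable_funB.
have p'E s' t' : uniq s' -> size t' = size s' ->
    (p' s' t')%:C%C = pattern_det (fun x => 1 - f x) s' t'.
  by move=> us st'; rewrite pattern_det_1B // (pattern_probE detP) ?size_map.
have := conditional_ge m1f (range_1B f01) p'E
  (fun s t => pattern_prob_ge0 P _ _) (t := map negb t) dvs.
by rewrite size_map /p' /= (mapK negbK) => /(_ st).
Qed.

(** In a descending list the head comes after every site of the tail, so both conditional bounds
    apply and each site adds at least the minimum. *)
Lemma seq_entropy_ge s : pairwise (fun x y => lexlt y x) s ->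
  (size s)%:R * Num.min (entropy2 (GM f)) (entropy2 (GM (fun x => 1 - f x))) <=
  seq_entropy P s.
Proof.
elim: s => [|v s IH] dvs; first by rewrite mul0r seq_entropy_nil.
have ds : pairwise (fun x y : 'rV[int]_d => lexlt y x) s by case/andP: dvs.
apply: le_trans (seq_entropy_cons P v s).
have mb : measurable_label (fun eta : config d => eta v).
  by move=> b; exact: measurable_coord.
have pE b t : label_prob P (fun eta : config d => (eta v, restriction s eta)) (b, t) =
    pattern_prob P (v :: s) (b :: t).
  rewrite /label_prob /pattern_prob; congr (fine (P _)); apply/seteqP; split => eta.
    by move=> [<- /(congr1 val) /= <-].
  by move=> [<- E]; congr (_, _); apply: val_inj.
have bound := partition_entropy_bit (mu := P) (@measurable_restriction d s) mb
  (GM_ge0 f) (GM_ge0 (fun x => 1 - f x)).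
rewrite /= -natr1 mulrDl mul1r; apply: le_trans (bound _ _).
- by rewrite lerD2r; exact: IH.
- move=> t; rewrite pE label_prob_restriction.
  by apply: pattern_prob_true; rewrite ?size_tuple.
- move=> t; rewrite pE label_prob_restriction.
  by apply: pattern_prob_false; rewrite ?size_tuple.
Qed.

End Bound.

Theorem proposition6p2 (R : realType) (d : nat) (hd : (1 <= d)%N)
    (f : d.-tuple R -> R)
    (f_periodic : Zd_periodic f)
    (f_measurable : measurable_fun [set: d.-tuple R] f)
    (f_range : forall x, 0 <= f x <= 1)
    (Pf : probability (config d) R)
    (Pf_determinantal : determinantal f Pf) :
  ((Num.min (entropy2 (GM f)) (entropy2 (GM (fun x => 1 - f x))))%:E
    <= ks_entropy (@config_shift d) Pf)%E.
Proof.
set m := Num.min _ _.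
have [n|l cl ml] := @box_rate_cvg R d f Pf Pf_determinantal m.
  (* The bound per site holds on the box listed in descending order, and entropy does not depend on
     the listing. *)
  have [L pL dL] := box_descending d n.+1.
  have := seq_entropy_ge f_measurable f_range Pf_determinantal dL.
  rewrite -/m (perm_size pL) size_box => /le_trans; apply.
  by apply: seq_entropy_sub => x; rewrite (perm_mem pL).
apply: (@le_trans _ _ l%:E); first by rewrite lee_fin.
(* The supremum dominates the rate of the partition by the symbol at the origin. *)
apply: ereal_sup_ubound => /=; exists 2, (@bit0 d); split.
  move=> i; pose g (t : 1.-tuple bool) : 'I_2 := if thead t then 1 else 0.
  have -> : @bit0 d = g \o @restriction d [:: 0] by [].
  exact: (measurable_label_comp Pf g (@measurable_restriction d [:: 0])).
rewrite /partition_rate.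
apply/esym/cvg_lim => //.
under eq_fun do rewrite box_join_entropy.
by apply: cvg_EFin; [exact: nearW|exact: cl].
Qed.
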